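(* Let $\Lambda$ be one of the grid graphs $T_{K,L}$, $G_{K,L}$, $C_{K,L}$ (with the parity requirements below), and consider the hard-core Metropolis Markov chain $\{X^\beta_t\}_{t\in\mathbb N}$ on $\Lambda$. There exists a constant $\Gamma(\Lambda)>0$ such that (i) for every $\varepsilon>0$, $\lim_{\beta\to\infty}\mathbb P\big(e^{\beta(\Gamma(\Lambda)-\varepsilon)}<\tau^{\mathbf e}_{\mathbf o}<e^{\beta(\Gamma(\Lambda)+\varepsilon)}\big)=1$; (ii) $\lim_{\beta\to\infty}\frac1\beta\log\mathbb E\,\tau^{\mathbf e}_{\mathbf o}=\Gamma(\Lambda)$; (iii) $\tau^{\mathbf e}_{\mathbf o}/\mathbb E\,\tau^{\mathbf e}_{\mathbf o}$ converges in distribution, as $\beta\to\infty$, to an exponential random variable with mean $1$. Moreover, if $\Lambda=G_{K,L}$ with $KL$ odd, then (i), (ii), (iii) also hold for the hitting time $\tau^{\mathbf o}_{\mathbf e}$ in place of $\tau^{\mathbf e}_{\mathbf o}$, with $\Gamma(\Lambda)$ replaced by $\Gamma(\Lambda)-1$.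
   Context: Grids: for integers $K,L\ge 2$, the site set is $\Lambda=\{(v_1,v_2):0\le v_1\le L-1,\ 0\le v_2\le K-1\}$ ($N=KL$ sites). In the open grid $G_{K,L}$, $v,w$ are adjacent iff $|v_1-w_1|+|v_2-w_2|=1$. The cylindrical grid $C_{K,L}$ (with $K$ even) has in addition the edges $(j,0)\sim(j,K-1)$ for all $j$. The toric grid $T_{K,L}$ (with $K$ and $L$ both even) has in addition to the cylindrical edges the edges $(0,i)\sim(L-1,i)$ for all $i$. A site is even if $v_1+v_2$ is even and odd otherwise; $V_e,V_o$ denote the sets of even and odd sites. Hard-core chain: the state space $\mathcal X$ is the set of $\sigma\in\{0,1\}^\Lambda$ with $\sigma(v)\sigma(w)=0$ for all adjacent $v,w$; $H(\sigma)=-\sum_{v}\sigma(v)$; $q(\sigma,\sigma')=1/N$ if $\sigma,\sigma'$ differ in exactly one site, $q(\sigma,\sigma')=0$ if they differ in more than one site, and $q(\sigma,\sigma)=1-\sum_{\eta\ne\sigma}q(\sigma,\eta)$. For $\beta>0$ the chain has transition probabilities $P_\beta(\sigma,\sigma')=q(\sigma,\sigma')e^{-\beta[H(\sigma')-H(\sigma)]^+}$ for $\sigma\ne\sigma'$ and $P_\beta(\sigma,\sigma)=1-\sum_{\sigma'\ne\sigma}P_\beta(\sigma,\sigma')$. $\mathbf e$ (resp. $\mathbf o$) is the configuration with particles exactly at the even (resp. odd) sites. For a state $x$ and set $A$, $\tau^x_A=\inf\{t>0:X^\beta_t\in A\}$ for the chain started at $X_0=x$; $\tau^x_y=\tau^x_{\{y\}}$.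 *)

(* Defs.v *)
From HB Require Import structures.
From mathcomp Require Import all_boot all_order all_algebra.
From mathcomp Require Import all_classical all_reals all_analysis.
Set Implicit Arguments. Unset Strict Implicit. Unset Printing Implicit Defensive.
Import Order.TTheory GRing.Theory Num.Theory.
Import numFieldNormedType.Exports.
Local Open Scope classical_set_scope.
Local Open Scope ring_scope.

Inductive grid_kind := Open | Cyl | Tor.

Definition site (K L : nat) := ('I_L * 'I_K)%type.

Definition distn (m n : nat) : nat := ((m - n) + (n - m))%N.

Definition adj (g : grid_kind) (K L : nat) (v w : site K L) : bool :=
  let open_e := (distn v.1 w.1 + distn v.2 w.2 == 1)%N in
  let cyl_e := (v.1 == w.1 :> nat) &&
     (((v.2 == 0 :> nat) && (w.2 == K.-1 :> nat)) ||
      ((v.2 == K.-1 :> nat) && (w.2 == 0 :> nat))) in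
  let tor_e := (v.2 == w.2 :> nat) &&
     (((v.1 == 0 :> nat) && (w.1 == L.-1 :> nat)) ||
      ((v.1 == L.-1 :> nat) && (w.1 == 0 :> nat))) in
  match g with
  | Open => open_e
  | Cyl => open_e || cyl_e
  | Tor => [|| open_e, cyl_e | tor_e]
  end.

Definition grid_ok (g : grid_kind) (K L : nat) : Prop :=
  (2 <= K)%N /\ (2 <= L)%N /\
  match g with
  | Open => True
  | Cyl => ~~ odd K
  | Tor => ~~ odd K /\ ~~ odd L
  end.

Definition config (K L : nat) := {ffun site K L -> bool}.

Definition feasible g K L (s : config K L) : bool :=
  [forall v, forall w, adj g v w ==> ~~ (s v && s w)].

Definition Ham (R : realType) K L (s : config K L) : R :=
  - (#|[set v | s v]|)%:R.

Definition ndiff K L (s s' : config K L) : nat := #|[set v | s v != s' v]|.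

Definition Poff (R : realType) g K L (beta : R) (s s' : config K L) : R :=
  if feasible g s' && (ndiff s s' == 1)%N then
    ((K * L)%:R)^-1 * expR (- beta * Num.max 0 (Ham R s' - Ham R s))
  else 0.

Definition Pbeta (R : realType) g K L (beta : R) (s s' : config K L) : R :=
  if s == s' then 1 - \sum_(e : config K L | e != s) Poff g beta s e
  else Poff g beta s s'.

Definition econf K L : config K L := [ffun v : site K L => ~~ odd (v.1 + v.2)].
Definition oconf K L : config K L := [ffun v : site K L => odd (v.1 + v.2)].

(** surv t x = P(X_1 <> y, ..., X_t <> y | X_0 = x) = P(tau^x_y > t). *)
Fixpoint surv (R : realType) g K L (beta : R) (y : config K L) (t : nat)
    (x : config K L) : R :=
  match t with
  | 0 => 1
  | t'.+1 => \sum_(z : config K L)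
       Pbeta g beta x z * (if z == y then 0 else surv g beta y t' z)
  end.

(** pmf of the hitting time: P(tau^x_y = t), with tau^x_y = inf{t > 0 : X_t = y}. *)
Definition hit_pmf (R : realType) g K L (beta : R) (x y : config K L) (t : nat) : R :=
  if t is t'.+1 then surv g beta y t' x - surv g beta y t x else 0.

Definition hit_prob (R : realType) g K L (beta : R) (x y : config K L)
    (S : pred nat) : R :=
  fine (\sum_(t <oo | S t) ((hit_pmf g beta x y t)%:E))%E.

(** E tau^x_y (in \bar R): +oo if tau = infinity with positive probability. *)
Definition hit_mean (R : realType) g K L (beta : R) (x y : config K L) : \bar R :=
  if (\sum_(t <oo) ((hit_pmf g beta x y t)%:E))%E == 1%E
  then (\sum_(t <oo) ((t%:R * hit_pmf g beta x y t)%:E))%E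
  else (+oo)%E.

Definition exp1_cdf (R : realType) (s : R) : R :=
  if s < 0 then 0 else 1 - expR (- s).

Definition hitting_asymptotics (R : realType) g K L (x y : config K L) (Gam : R) : Prop :=
  (forall eps : R, 0 < eps ->
     hit_prob g beta x y
       (fun t => (expR (beta * (Gam - eps)) < t%:R) && (t%:R < expR (beta * (Gam + eps))))
       @[beta --> +oo] --> (1 : R))
  /\ (ln (fine (hit_mean g beta x y)) / beta @[beta --> +oo] --> Gam)
  /\ (forall s : R,
        hit_prob g beta x y (fun t => t%:R <= s * fine (hit_mean g beta x y))
          @[beta --> +oo] --> exp1_cdf s).

(* Main.v *)
(* Let m be the largest number such that the even and the odd configurations e, o communicate
   through configurations with at least m particles, and Gam = n(e) - m, n counting particles.
   For a reversible Metropolis chain, leaving the basin of e within time t has probability at most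
   C t exp (- beta Gam), while the Green function on the diagonal is bounded by C exp (beta d) as
   soon as the target can be reached by a path on which at most d particles are lost. This gives
   E tau = exp (beta Gam) up to constants, and (i), (ii) follow. If moreover every other
   configuration reaches {e, o} by losing only D < Gam particles, then {e, o} is hit much earlier
   than exp (beta Gam) from anywhere; hence E[tau - t | tau > t] is close to E tau for all t, and
   this forces the exponential law.

   The inequality D < Gam does not require the exact value of Gam. Upper bound on D: clear the
   minority colour in a boundary line, and then sweep the grid starting from the resulting pure
   line, which costs a single particle; a line carrying both colours has few particles of one of
   them. Lower bound on Gam: on a path from e to o there is a time at which either all rows (in
   pairs) or all columns are mixed, and each of them then misses a particle. *)
Require Import Defs.
From HB Require Import structures.
From mathcomp Require Import all_boot all_order all_algebra.
From mathcomp Require Import all_classical all_reals all_analysis.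
From mathcomp Require Import zify ring lra.
Set Implicit Arguments.
Unset Strict Implicit.
Unset Printing Implicit Defensive.
Import Order.TTheory GRing.Theory Num.Theory.
Import numFieldNormedType.Exports.
Local Open Scope ring_scope.

(** * Reversible chains *)

(** The gap [D < Gam] survives crude counting because each lower bound is about twice the matching
    upper bound. A boundary line of length [K] crossed by open lines costs at most a quarter of [K]
    plus one, against the [K./2] pairs of rows. When the crossing lines are cycles, each refilled
    site of the boundary line faces two outside neighbours and the cost grows to [K./2] plus one;
    but a cyclic row is rigid by itself, so rows are counted unpaired and the lower bound doubles
    too. On an odd grid the gap must hold even against [Gam - 1], which the unpaired last row and
    column provide. The diagonal of the Green function obeys a quadratic inequality: its Dirichlet
    energy is at most [pi y] times its peak, while it must fall from that peak to 0 along the path.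
    The exponential law is reached through the geometric one: when the mean residual time is nearly
    constant, the normalised tail sums of the survival function nearly satisfy the recursion of a
    geometric sequence of ratio [1 - 1/T]. *)

Section ReversibleChain.
Variables (R : realType) (T : finType) (P : T -> T -> R) (pi : T -> R).
Hypothesis P_ge0 : forall x z, 0 <= P x z.
Hypothesis P_sum1 : forall x, \sum_z P x z = 1.
Hypothesis pi_gt0 : forall x, 0 < pi x.
Hypothesis P_rev : forall x z, pi x * P x z = pi z * P z x.

Implicit Types (A W : pred T) (f g : T -> R).

Lemma pi_ge0 x : 0 <= pi x. Proof. exact: ltW. Qed.

Definition killed A f (x : T) : R := \sum_(z | ~~ A z) P x z * f z.

Lemma killedE A f x : killed A f x = \sum_z P x z * (if A z then 0 else f z).
Proof.
rewrite /killed big_mkcond; apply: eq_bigr => z _.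
by case: (A z); rewrite ?mulr0.
Qed.

(* [survival A t x] is P_x(tau_A > t) with tau_A counted from time 1. *)
Definition survival A t : T -> R := iter t (killed A) (fun=> 1).

Lemma survivalS A t x :
  survival A t.+1 x = \sum_(z | ~~ A z) P x z * survival A t z.
Proof. by []. Qed.

Lemma killed_le A f g x :
  (forall z, ~~ A z -> f z <= g z) -> killed A f x <= killed A g x.
Proof. by move=> fg; apply: ler_sum => z nAz; rewrite ler_wpM2l ?fg. Qed.

Lemma killed1_le1 A x : killed A (fun=> 1) x <= 1.
Proof.
have -> : killed A (fun=> 1) x = \sum_(z | ~~ A z) P x z.
  by apply: eq_bigr => z _; rewrite mulr1.
by rewrite -(P_sum1 x) [leRHS](bigID (fun z => ~~ A z)) /= lerDl sumr_ge0.
Qed.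

Lemma iter_killed_le A f g t x : ~~ A x ->
  (forall z, ~~ A z -> f z <= g z) ->
  iter t (killed A) f x <= iter t (killed A) g x.
Proof.
by elim: t x => [|t IH] x nAx fg /=; [exact: fg | apply: killed_le => z nAz; exact: IH].
Qed.

Lemma iter_killed_lin A (a b : R) f g t x :
  iter t (killed A) (fun z => a * f z + b * g z) x =
  a * iter t (killed A) f x + b * iter t (killed A) g x.
Proof.
elim: t x => [//|t IH] x /=.
rewrite /killed !mulr_sumr -big_split /=.
by apply: eq_bigr => z _; rewrite IH mulrDr !(mulrCA (P x z)).
Qed.

Lemma survival_ge0 A t x : 0 <= survival A t x.
Proof.
elim: t x => [|t IH] x; first exact: ler01.
by rewrite survivalS sumr_ge0 // => z _; rewrite mulr_ge0.
Qed.

Lemma survival_le1 A t x : survival A t x <= 1.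
Proof.
elim: t x => [|t IH] x //; rewrite survivalS.
by apply: le_trans (killed1_le1 A x); apply: killed_le.
Qed.

Lemma survival_leS A t x : survival A t.+1 x <= survival A t x.
Proof.
elim: t x => [|t IH] x; first exact: survival_le1.
by rewrite survivalS [leRHS]survivalS; apply: killed_le.
Qed.

Lemma survival_le A m n x : (m <= n)%N -> survival A n x <= survival A m x.
Proof.
move=> /subnK <-; elim: (n - m)%N => [|k IH] //.
by rewrite addSn (le_trans (survival_leS _ _ _)).
Qed.

Lemma survivalD A t u x :
  survival A (t + u) x = iter t (killed A) (survival A u) x.
Proof. by rewrite /survival iterD. Qed.

Definition dirichlet f : R :=
  2^-1 * \sum_x \sum_z pi x * P x z * (f x - f z) ^+ 2.

Lemma dirichletE f :
  dirichlet f = \sum_x pi x * f x * (f x - \sum_z P x z * f z).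
Proof.
have E1 : \sum_x \sum_z pi x * P x z * f x ^+ 2 = \sum_x pi x * f x ^+ 2.
  apply: eq_bigr => x _; rewrite -mulr_suml -mulr_sumr P_sum1; ring.
have E2 : \sum_x \sum_z pi x * P x z * f z ^+ 2 = \sum_x pi x * f x ^+ 2.
  rewrite exchange_big /= -E1; apply: eq_bigr => x _; apply: eq_bigr => z _.
  by rewrite P_rev.
rewrite /dirichlet.
transitivity (2^-1 * (2 * \sum_x pi x * f x ^+ 2
    - 2 * \sum_x \sum_z pi x * P x z * (f x * f z))); last first.
  rewrite mulrBr !mulrA mulVf // !mul1r -sumrB; apply: eq_bigr => x _.
  rewrite mulrBr; congr (_ - _); first by ring.
  by rewrite mulr_sumr; apply: eq_bigr => z _; ring.
congr (_ * _); rewrite [2 * _ in X in X - _]mulrDl !mul1r -{1}E1 -E2.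
rewrite -big_split /= mulr_sumr -sumrB; apply: eq_bigr => x _.
rewrite -big_split /= mulr_sumr -sumrB; apply: eq_bigr => z _; ring.
Qed.

Lemma edge_le_dirichlet f u v :
  pi u * P u v * (f u - f v) ^+ 2 <= dirichlet f.
Proof.
have term_ge0 x z : 0 <= pi x * P x z * (f x - f z) ^+ 2.
  by rewrite mulr_ge0 ?sqr_ge0 // mulr_ge0 ?pi_ge0.
have [->|neq] := eqVneq u v.
  rewrite subrr expr0n mulr0 mulr_ge0 ?invr_ge0 //.
  by do 2!(apply: sumr_ge0 => ? _).
rewrite /dirichlet pair_big /= (bigD1 (u, v)) //= (bigD1 (v, u)) /=; last first.
  by apply: contra neq => /eqP[-> _].
have -> : pi v * P v u * (f v - f u) ^+ 2 = pi u * P u v * (f u - f v) ^+ 2.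
  by rewrite (P_rev v u) -sqrrN opprB.
set a := _ * _ ^+ 2; set b := \sum_(_ | _) _.
have : 0 <= b by rewrite sumr_ge0.
lra.
Qed.

(** * Green functions and the Dirichlet form *)

Section Green.
Variable A : pred T.

(* [green n y x] is the mean number of visits to y at times < n, from x, before A is entered. *)
Fixpoint green n (y x : T) : R :=
  if n is n'.+1 then
    if A x then 0 else (x == y)%:R + \sum_z P x z * green n' y z
  else 0.

Fixpoint occupation n (x : T) : R :=
  if n is n'.+1 then
    if A x then 0 else 1 + \sum_z P x z * occupation n' z
  else 0.

Lemma green_ge0 n y x : 0 <= green n y x.
Proof.
elim: n x => [|n IH] x //=; case: ifP => // _.
by rewrite addr_ge0 // sumr_ge0 // => z _; rewrite mulr_ge0.
Qed.

Lemma green_leS n y x : green n y x <= green n.+1 y x.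
Proof.
elim: n x => [|n IH] x; first exact: green_ge0.
rewrite /= -/(green n.+1 y) /=; case: ifP => // nA.
by rewrite lerD2l; apply: ler_sum => z _; rewrite ler_wpM2l //; exact: IH.
Qed.

(** Nothing is counted before the first visit to [y], and after it the walk is one from [y] with
    less time left; monotonicity in the horizon does the rest. *)
Lemma green_le_diag n y x : green n y x <= green n y y.
Proof.
elim: n x => [|n IH] x //.
have [->//|neq] := eqVneq x y.
apply: le_trans (green_leS n y y) => /=.
case: ifP => _; first exact: green_ge0.
rewrite (negbTE neq) add0r.
apply: (@le_trans _ _ (\sum_z P x z * green n y y)).
  by apply: ler_sum => z _; rewrite ler_wpM2l.
by rewrite -mulr_suml P_sum1 mul1r.
Qed.

Lemma sum_green n x : \sum_y green n y x = occupation n x.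
Proof.
elim: n x => [|n IH] x /=; first by rewrite big1.
case: ifP => _; first by rewrite big1.
rewrite big_split /=; congr (_ + _).
  by rewrite (bigD1 x) //= eqxx big1 ?addr0 // => y /negbTE; rewrite eq_sym => ->.
rewrite exchange_big /=; apply: eq_bigr => z _.
by rewrite -mulr_sumr IH.
Qed.

Lemma occupationE n x : ~~ A x -> occupation n x = \sum_(t < n) survival A t x.
Proof.
elim: n x => [|n IH] x nAx /=; first by rewrite big_ord0.
rewrite (negbTE nAx) big_ord_recl /=; congr (_ + _).
rewrite (bigID (fun z => ~~ A z)) /= [X in _ + X]big1 ?addr0; last first.
  by move=> z; rewrite negbK => Az; case: n {IH} => [|n] /=; rewrite ?Az mulr0.
rewrite /killed exchange_big /=; apply: eq_bigr => z nAz.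
by rewrite IH // mulr_sumr.
Qed.

(** Without time horizon, [f - P f] would be the indicator of [y] off [A]. With horizon [n] it is
    still at most that indicator, since the Green function grows with the horizon; paired with
    [pi f], only the term at [y] can be positive. *)
Lemma dirichlet_green n y : dirichlet (green n y) <= pi y * green n y y.
Proof.
rewrite dirichletE (bigD1 y) //= -[leRHS]addr0; apply: lerD; last first.
  rewrite -oppr_ge0 -sumrN sumr_ge0 // => x /negbTE neq.
  rewrite -mulrN mulr_ge0 ?mulr_ge0 ?pi_ge0 ?green_ge0 // oppr_ge0 subr_le0.
  case: n => [|n] /=; first by rewrite sumr_ge0 // => z _; rewrite mulr0.
  case: ifP => [_|nA]; last first.
    rewrite neq add0r; apply: ler_sum => z _; rewrite ler_wpM2l //.
    exact: green_leS n y z.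
  rewrite sumr_ge0 // => z _; rewrite mulr_ge0 //; exact: (green_ge0 n.+1).
rewrite -mulrA ler_wpM2l ?pi_ge0 // -[leRHS]mulr1 ler_wpM2l ?green_ge0 //.
rewrite lerBlDr; case: n => [|n] /=.
  by rewrite addr_ge0 ?sumr_ge0 // => z _; rewrite mulr0.
case: ifP => [_|nA].
  rewrite addr_ge0 ?sumr_ge0 // => z _; rewrite mulr_ge0 //.
  exact: (green_ge0 n.+1).
rewrite eqxx lerD2l; apply: ler_sum => z _; rewrite ler_wpM2l //.
exact: green_leS n y z.
Qed.

Lemma path_increment f (e : rel T) (d : R) (x : T) (p : seq T) :
  (forall u v, e u v -> `|f u - f v| <= d) ->
  path e x p -> `|f x - f (last x p)| <= (size p)%:R * d.
Proof.
move=> fe; elim: p x => [|z p IH] x /=; first by rewrite subrr normr0 mul0r.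
case/andP=> exz /IH {}IH.
rewrite -(subrKA (f z)) mulrSr mulrDl mul1r [leRHS]addrC.
by rewrite (le_trans (ler_normD _ _)) // lerD // fe.
Qed.

(** On each edge the increment of [f] is at most the square root of its energy over [kap], and a
    path without repetition brings [f] from [f y] down to 0 on [A]. So [f y ^+ 2] is at most a
    constant times [dirichlet f / kap], hence times [pi y * f y / kap], and one factor [f y]
    cancels. *)
Lemma green_diag_le (e : rel T) (kap : R) n y a : 0 < kap -> A a ->
  (forall u v, e u v -> kap <= pi u * P u v) -> connect e y a ->
  green n y y <= #|T|%:R ^+ 2 * pi y / kap.
Proof.
move=> kap0 Aa ekap /connectP[p0 /shortenP[p ep up _] aE]; rewrite aE in Aa.
set f := green n y; set d := Num.sqrt (dirichlet f / kap).
have dir0 : 0 <= dirichlet f.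
  by rewrite /dirichlet mulr_ge0 ?invr_ge0 // ?sumr_ge0 // => x _;
     rewrite sumr_ge0 // => z _; rewrite mulr_ge0 ?sqr_ge0 // mulr_ge0 ?pi_ge0.
have fe u v : e u v -> `|f u - f v| <= d.
  move=> /ekap le; rewrite -(ler_pXn2r (n := 2)) // ?nnegrE ?sqrtr_ge0 //.
  rewrite sqr_sqrtr ?divr_ge0 ?(ltW kap0) // -normrX ger0_norm ?sqr_ge0 //.
  rewrite ler_pdivlMr // mulrC (le_trans _ (edge_le_dirichlet f u v)) //.
  by rewrite ler_wpM2r ?sqr_ge0.
have := path_increment fe ep.
have -> : f (last y p) = 0 by rewrite /f; case: n {f d dir0 fe} => //= n; rewrite Aa.
rewrite subr0 ger0_norm ?green_ge0 // => fy.
have szp : (size p)%:R <= #|T|%:R :> R.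
  rewrite ler_nat; have := card_size (y :: p); have /card_uniqP := up.
  by move=> szE _; rewrite (@leq_trans (size (y :: p))) // -szE max_card.
have {}fy : f y <= #|T|%:R * d by apply: le_trans fy _; rewrite ler_wpM2r ?sqrtr_ge0.
have f0 : 0 <= f y by exact: green_ge0.
have := f0; rewrite le_eqVlt => /predU1P[<-|fpos].
  by rewrite divr_ge0 ?mulr_ge0 ?exprn_ge0 ?pi_ge0 // ltW.
have : f y ^+ 2 <= #|T|%:R ^+ 2 * (dirichlet f / kap).
  rewrite -(sqr_sqrtr (a := dirichlet f / kap)) ?divr_ge0 ?(ltW kap0) // -exprMn.
  by rewrite ler_pXn2r // nnegrE // mulr_ge0 // sqrtr_ge0.
move=> h; rewrite -(ler_pM2r fpos) -expr2 (le_trans h) //.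
rewrite (_ : _ * f y = #|T|%:R ^+ 2 * (pi y * f y / kap)); last by ring.
by rewrite ler_wpM2l ?exprn_ge0 // ler_pM2r ?invr_gt0 // dirichlet_green.
Qed.

Lemma occupation_le n (B : R) x :
  (forall y, ~~ A y -> green n y y <= B) -> 0 <= B -> occupation n x <= #|T|%:R * B.
Proof.
move=> gB B0; rewrite -sum_green.
apply: (@le_trans _ _ (\sum_(y : T) B)); last by rewrite sumr_const mulr_natl.
apply: ler_sum => y _; apply: le_trans (green_le_diag n y x) _.
have [Ay|nAy] := boolP (A y); last exact: gB.
by case: n {gB} => //= n; rewrite Ay.
Qed.

End Green.

(** The chain is started from [pi] restricted to [W] instead of from [s]: by reversibility its mass
    on [W] stays below [pi], so each step sends at most the boundary flow out of [W], and [y] lies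
    outside. The start at [s] is one nonnegative term of this sum. *)
Lemma escape_le W y s n : W s -> ~~ W y ->
  pi s * (1 - survival (pred1 y) n s) <=
  n%:R * \sum_(x | W x) \sum_(z | ~~ W z) pi x * P x z.
Proof.
move=> Ws nWy; set c := \sum_(x | W x) _.
have sv1 k x : 0 <= 1 - survival (pred1 y) k x by rewrite subr_ge0 survival_le1.
suff: \sum_(x | W x) pi x * (1 - survival (pred1 y) n x) <= n%:R * c.
  apply: le_trans; rewrite (bigD1 s) //= lerDl sumr_ge0 // => x _.
  by rewrite mulr_ge0 ?pi_ge0.
elim: n => [|n IH].
  by rewrite mul0r big1 // => x _; rewrite subrr mulr0.
rewrite mulrSr mulrDl mul1r; apply: le_trans (lerD IH (lexx c)).
have step x : 1 - survival (pred1 y) n.+1 x <=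
    \sum_(z | W z) P x z * (1 - survival (pred1 y) n z) + \sum_(z | ~~ W z) P x z.
  rewrite -{1}(P_sum1 x) survivalS -/(killed _ _ _) killedE -sumrB (bigID W) /=.
  apply: lerD; apply: ler_sum => z Wz.
    rewrite (negbTE (_ : z != y)) ?mulrBr ?mulr1 //.
    by apply: contraNneq nWy => <-.
  by rewrite gerBl mulr_ge0 //; case: ifP; rewrite ?survival_ge0.
apply: (@le_trans _ _ (\sum_(x | W x) (\sum_(z | W z) pi z * P z x *
    (1 - survival (pred1 y) n z) + \sum_(z | ~~ W z) pi x * P x z))).
  apply: ler_sum => x Wx; apply: le_trans (ler_wpM2l (pi_ge0 x) (step x)) _.
  rewrite mulrDr !mulr_sumr lerD //; apply: ler_sum => z _.
  by rewrite mulrA P_rev.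
rewrite big_split /= lerD2r exchange_big /=; apply: ler_sum => z _.
rewrite -mulr_suml -mulr_sumr ler_wpM2r // -[leRHS]mulr1 ler_wpM2l ?pi_ge0 //.
by rewrite -(P_sum1 z) [leRHS](bigID W) /= lerDl sumr_ge0.
Qed.

(** * Restarting at a metastable state, and the geometric law *)

Section Renewal.
Variables (s y : T).
Hypothesis s_neq_y : s != y.

Let f t := survival (pred1 y) t.
Let A : pred T := pred2 s y.
(** The value 0 at [s] makes time 0 count: [v t x] is the probability, from [x], that [s] is avoided
    at times 0 to [t] and [y] at times 1 to [t]. *)
Let v t x := if x == s then 0 else survival A t x.

(** The first factor is the probability that [s] is visited by time [m] while [y] is avoided that
    long. At the first such visit the chain starts afresh, and surviving [u] steps from there
    entails surviving [u] steps from [x]. *)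
Lemma survival_restart m u x : x != y ->
  (f m x - v m x) * f u s <= f u x.
Proof.
have f01 t z : 0 <= f t z <= 1 by rewrite survival_ge0 survival_le1.
elim: m x => [|m IH] x xy; have [->|xs] := eqVneq x s.
- by rewrite /v eqxx subr0 mul1r.
- by rewrite /v (negbTE xs) subrr mul0r; case/andP: (f01 u x).
- by rewrite /v eqxx subr0 ler_piMl //; case/andP: (f01 m.+1 s); case/andP: (f01 u s).
apply: le_trans (survival_leS _ _ _); rewrite /v (negbTE xs) -/(f u.+1 x).
rewrite /f /survival !iterS -/(survival _) !killedE -sumrB mulr_suml.
have AE z : A z = (z == s) || (z == y) by [].
apply: ler_sum => z _ /=; rewrite AE -!/(survival _ _ _) -!/(f _ _).
have [->|zy] := eqVneq z y; first by rewrite orbT mulr0 subrr mul0r.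
have := IH z zy; rewrite /v orbF; case: eqVneq => /= _ h.
  by rewrite mulr0 subr0 -mulrA ler_wpM2l // (le_trans _ h) // subr0.
by rewrite -mulrBr -mulrA ler_wpM2l.
Qed.

Lemma occupation_restart n x : x != y ->
  \sum_(t < n) f t x <= \sum_(t < n) v t x + \sum_(t < n) f t s.
Proof.
elim: n x => [|n IH] x xy; first by rewrite !big_ord0 addr0.
have [->|xs] := eqVneq x s.
  by rewrite lerDr sumr_ge0 // => t _; rewrite /v eqxx.
have S_le : \sum_(t < n) f t s <= \sum_(t < n.+1) f t s.
  by rewrite big_ord_recr /= lerDl survival_ge0.
apply: le_trans (lerD (lexx _) S_le).
rewrite !big_ord_recl /= -addrA lerD //; first by rewrite /v (negbTE xs).
set S := \sum_(t < n) f t s in IH *.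
have S0 : 0 <= S by rewrite sumr_ge0 // => t _; exact: survival_ge0.
have -> : \sum_(i < n) f (bump 0 i) x = \sum_(z | z != y) P x z * \sum_(t < n) f t z.
  rewrite /bump /f /= /killed exchange_big /=; apply: eq_bigr => z _.
  by rewrite mulr_sumr.
have -> : \sum_(i < n) v (bump 0 i) x =
    \sum_(z | z != y) P x z * \sum_(t < n) v t z.
  rewrite /bump /v (negbTE xs) /= /killed exchange_big /=.
  rewrite big_mkcond [RHS]big_mkcond; apply: eq_bigr => z _ /=.
  rewrite negb_or; case: (z == y); rewrite ?andbF ?andbT //; case: (z == s) => /=.
    by rewrite big1 ?mulr0.
  by rewrite mulr_sumr.
apply: (@le_trans _ _ (\sum_(z | z != y) P x z * (\sum_(t < n) v t z + S))).
  by apply: ler_sum => z zy; rewrite ler_wpM2l // IH.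
under eq_bigr do rewrite mulrDr.
rewrite big_split /= lerD2l -mulr_suml -[leRHS]mul1r ler_wpM2r //.
by rewrite -(P_sum1 x) [leRHS](bigID (fun z => z != y)) /= lerDl sumr_ge0.
Qed.

(* If {s, y} is reached within m steps up to probability eps, then at time t the chain either is
   back at s or was close to y already at time t - m, i.e. had been at s shortly before. *)
Lemma survival_window (eps : R) m t : 0 <= eps ->
  (forall x, x != y -> v m x <= eps) ->
  f t s - f (t + m) s <= eps + (1 - f (m + m) s).
Proof.
move=> eps0 veps.
have f01 k z : 0 <= f k z <= 1 by rewrite survival_ge0 survival_le1.
have /andP[fm0 fm1] := f01 (m + m)%N s.
have step x : x != y -> f m x <= 1 * f (m + m) x + (eps + (1 - f (m + m) s)) * 1.
  move=> xy; have := survival_restart m (m + m) xy; have := veps x xy.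
  have /andP[fx0 fx1] := f01 m x.
  have v0 : 0 <= v m x by rewrite /v; case: ifP => // _; exact: survival_ge0.
  set F := f (m + m) s in fm0 fm1 *; move=> ve h.
  rewrite mul1r mulr1.
  have : (f m x - v m x) * (1 - F) <= 1 - F.
    by apply: ler_piMl; rewrite ?subr_ge0 // lerBlDr (le_trans fx1) // lerDl.
  move: h ve; lra.
(* For [t < m] there is no room to look back [m] steps, but then [t + m] is below [m + m] and the
   last term of the bound suffices. *)
have [tm|mt] := ltnP t m.
  have /andP[_ ft1] := f01 t s.
  have : f (m + m) s <= f (t + m) s by apply: survival_le; rewrite leq_add2r ltnW.
  by move: eps0 ft1; lra.
have -> : t = (t - m + m)%N by rewrite subnK.
set k := (t - m)%N; rewrite -addnA /f (survivalD _ k m) (survivalD _ k (m + m)) -!/(f _).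
have := @iter_killed_le (pred1 y) (f m) _ k s s_neq_y (fun x xy => step x xy).
rewrite (iter_killed_lin _ 1 _ _ (fun=> 1)) mul1r -/(survival _ _ _) -/(f k s).
have /andP[fk0 fk1] := f01 k s.
have c0 : 0 <= eps + (1 - f (m + m) s) by lra.
have := ler_piMr c0 fk1.
lra.
Qed.

(* With S_n = sum_{t<n} P(tau > t) -> T = E tau, the tail T - S_t is about T P(tau > t). *)
Lemma survival_tail_ge (eps : R) m n t : 0 <= eps ->
  (forall x, x != y -> v m x <= eps) ->
  (f (t + m) s - eps) * \sum_(u < n) f u s <= \sum_(u < n) f (t + u) s.
Proof.
move=> eps0 veps; rewrite mulr_sumr; apply: ler_sum => u _.
have f01 k z : 0 <= f k z <= 1 by rewrite survival_ge0 survival_le1.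
have /andP[fu0 _] := f01 u s; have /andP[ft0 ft1] := f01 t s.
have step x : x != y -> f u s * f m x + (- (f u s * eps)) * 1 <= f u x.
  move=> xy; have := survival_restart m u xy; have := ler_wpM2l fu0 (veps x xy).
  by set a := f u s; set b := f u x; nra.
rewrite /f (survivalD _ t m) (survivalD _ t u) -!/(f _).
apply: le_trans (@iter_killed_le (pred1 y) _ (f u) t s s_neq_y (fun x xy => step x xy)).
rewrite (iter_killed_lin _ _ _ (f m) (fun=> 1)) -/(survival _ _ _) -/(f t s).
rewrite mulrBl mulrC lerD2l mulNr lerN2 [leRHS]mulrC ler_piMr ?mulr_ge0 //.
Qed.

(** By the Markov property at time [t]: a surviving state reaches [s] or [y] in mean time at most
    [E], and from [s] on the remaining time is a fresh copy. *)
Lemma survival_tail_le (E : R) n t :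
  (forall x, x != y -> \sum_(u < n) v u x <= E) ->
  \sum_(u < n) f (t + u) s <= f t s * (E + \sum_(u < n) f u s).
Proof.
move=> vE; set S := \sum_(u < n) f u s.
have -> : \sum_(u < n) f (t + u) s =
    iter t (killed (pred1 y)) (fun x => \sum_(u < n) f u x) s.
  rewrite /f; elim: t s => [|t IH] x //=.
  rewrite /killed; under [RHS]eq_bigr do rewrite -IH mulr_sumr.
  by rewrite exchange_big.
have step x : x != y -> \sum_(u < n) f u x <= (E + S) * 1 + 0 * 1.
  move=> xy; have := occupation_restart n xy; have := vE x xy.
  by rewrite -/S mulr1 mul0r addr0; lra.
apply: le_trans (@iter_killed_le (pred1 y) _ _ t s s_neq_y (fun x xy => step x xy)) _.
rewrite (iter_killed_lin _ _ _ (fun=> 1) (fun=> 1)) -/(survival _ _ _) -/(f t s).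
by rewrite mul0r addr0 mulrC.
Qed.

(** The normalised tail [gam t = (T0 - S t) / T0] satisfies [gam t.+1 = gam t - f t s / T0] exactly.
    Once [gam t] is within [eta] of [f t s], this is the geometric recursion up to [eta / T0] per
    step, and the errors add up to at most [eta * (n / T0)]. *)
Lemma exponential_approx (E T0 d eta : R) m :
  (0 < m)%N -> 1 <= T0 ->
  (forall n x, x != y -> \sum_(u < n) v u x <= E) ->
  (forall n, \sum_(u < n) f u s <= T0) ->
  (\sum_(u < n) f u s @[n --> \oo] --> T0)%classic ->
  1 - f (m + m) s <= d -> E / T0 <= eta -> 2 * (E / m%:R) + d <= eta ->
  forall n, `|f n s - (1 - T0^-1) ^+ n| <= eta * (1 + n%:R / T0).
Proof.
move=> m0 T1 vE leT cT fd eta1 eta2 n.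
have Tpos : 0 < T0 by exact: lt_le_trans T1.
have mpos : 0 < m%:R :> R by rewrite ltr0n.
have f01 k z : 0 <= f k z <= 1 by rewrite survival_ge0 survival_le1.
pose S k := \sum_(u < k) f u s.
pose eps := E / m%:R.
have E0 : 0 <= E by have := vE 0%N s s_neq_y; rewrite big_ord0.
have eps0 : 0 <= eps by rewrite divr_ge0.
(* Markov's inequality: the mean time to reach [s] or [y] is at most [E]. *)
have veps x : x != y -> v m x <= eps.
  move=> xy; rewrite ler_pdivlMr // mulrC (le_trans _ (vE m x xy)) //.
  have -> : m%:R * v m x = \sum_(u < m) v m x by rewrite sumr_const card_ord mulr_natl.
  apply: ler_sum => u _.
  by rewrite /v; case: ifP => // _; apply: survival_le; exact: ltnW.
have SD t k : S (t + k)%N = S t + \sum_(u < k) f (t + u) s by rewrite /S big_split_ord.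
have up t : T0 - S t <= f t s * (E + T0).
  rewrite lerBlDl -[leLHS](cvg_lim _ cT) //; apply: limr_le; first exact: cvgP cT.
  apply: nearW => k; apply: (@le_trans _ _ (S (t + k)%N)).
    by rewrite addnC SD lerDl sumr_ge0 // => u _; case/andP: (f01 (k + u)%N s).
  rewrite SD lerD2l; have := survival_tail_le t (vE k).
  move=> /le_trans; apply; case/andP: (f01 t s) => ft0 _.
  by rewrite ler_wpM2l // lerD2l.
have lo t : (f (t + m) s - eps) * T0 <= T0 - S t.
  have cM : ((f (t + m) s - eps) * S k @[k --> \oo] --> (f (t + m) s - eps) * T0)%classic.
    by apply: cvgM => //; exact: cvg_cst.
  rewrite -[leLHS](cvg_lim _ cM) //; apply: limr_le; first exact: cvgP cM.
  apply: nearW => k; have := survival_tail_ge k t eps0 veps.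
  move=> /le_trans; apply; rewrite lerBrDl -SD; exact: leT.
pose gam t := (T0 - S t) / T0.
(* The lower bound spends [E / m] twice, in [lo] and in [survival_window], and [d] once; the upper
   bound spends [E / T0]. *)
have gamf t : `|gam t - f t s| <= eta.
  rewrite ler_distl; apply/andP; split.
    rewrite ler_pdivlMr //; apply: le_trans (lo t); rewrite ler_wpM2r ?(ltW Tpos) //.
    have := survival_window t eps0 veps; move: fd eta2; rewrite -/eps; lra.
  rewrite ler_pdivrMr //; apply: le_trans (up t) _; case/andP: (f01 t s) => ft0 ft1.
  rewrite mulrDr mulrDl addrC lerD2l.
  by move: eta1; rewrite ler_pdivrMr //; nra.
have q0 : 0 <= 1 - T0^-1 <= 1.
  by rewrite subr_ge0 invf_le1 // T1 gerBl invr_ge0 ltW.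
have eta0 : 0 <= eta by apply: le_trans eta1; rewrite divr_ge0 // ltW.
have gamq t : `|gam t - (1 - T0^-1) ^+ t| <= eta * (t%:R / T0).
  elim: t => [|t IH].
    by rewrite /gam /S big_ord0 subr0 divff ?gt_eqF // subrr normr0 mul0r mulr0.
  have -> : gam t.+1 - (1 - T0^-1) ^+ t.+1 =
      (gam t - (1 - T0^-1) ^+ t) * (1 - T0^-1) + (gam t - f t s) / T0.
    rewrite /gam {1}/S big_ord_recr /= -/(S t) exprS; ring.
  apply: le_trans (ler_normD _ _) _; rewrite !normrM.
  rewrite (ger0_norm (x := T0^-1)) ?invr_ge0 ?(ltW Tpos) //.
  case/andP: q0 => q0 q1; rewrite (ger0_norm q0).
  have -> : eta * (t.+1%:R / T0) = eta * (t%:R / T0) + eta / T0.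
    by rewrite -[t.+1%:R]natr1; ring.
  apply: lerD; last by rewrite ler_wpM2r ?invr_ge0 ?(ltW Tpos).
  by apply: le_trans IH; rewrite ler_piMr.
rewrite -(subrKA (gam n)) mulrDr mulr1 (le_trans (ler_normD _ _)) // lerD //.
by rewrite distrC.
Qed.

End Renewal.
End ReversibleChain.

(** * Laws of hitting times *)

Section HittingTimeLaw.
Variable R : realType.
Local Open Scope classical_set_scope.

Lemma nneseries_EFin (u : nat -> R) (S : pred nat) (l : R) :
  \sum_(0 <= i < n | S i) u i @[n --> \oo] --> l ->
  (\sum_(t <oo | S t) (u t)%:E)%E = l%:E.
Proof.
move=> ul; apply: cvg_lim => //.
under eq_fun do rewrite sumEFin.
by apply/fine_cvgP; split; first exact: nearW.
Qed.

Variables (f : nat -> R).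
Hypothesis f0 : f 0 = 1.
Hypothesis f_ge0 : forall n, 0 <= f n.
Hypothesis f_leS : forall n, f n.+1 <= f n.

Let pmf t := if t is t'.+1 then f t' - f t else 0.

Lemma pmf_ge0 t : 0 <= pmf t.
Proof. by case: t => //= t; rewrite subr_ge0. Qed.

Lemma nonincreasing_le m n : (m <= n)%N -> f n <= f m.
Proof.
move=> /subnK <-; elim: (n - m)%N => [|k IH] //.
by rewrite addSn (le_trans (f_leS _)).
Qed.

Lemma sum_pmf m n : (m <= n)%N -> \sum_(m.+1 <= t < n.+1) pmf t = f m - f n.
Proof.
move=> mn; rewrite big_add1 /= -[RHS]opprB -(telescope_sumr _ mn) -sumrN.
by apply: eq_bigr => i _; rewrite opprB.
Qed.

Lemma sum_pmf0 n : \sum_(0 <= t < n.+1) pmf t = 1 - f n.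
Proof. by rewrite big_nat_recl //= add0r -f0 -sum_pmf // big_add1. Qed.

Lemma pmf_series_cvg (S : pred nat) :
  exists l : R, [/\ \sum_(0 <= i < n | S i) pmf i @[n --> \oo] --> l,
    (forall n, \sum_(0 <= i < n | S i) pmf i <= l) & l <= 1].
Proof.
set u := fun n => \sum_(0 <= i < n | S i) pmf i.
have u_nd : nondecreasing_seq u.
  apply/nondecreasing_seqP => n; rewrite /u big_mkcond [leRHS]big_mkcond.
  rewrite big_nat_recr //= lerDl; case: ifP => // _; exact: pmf_ge0.
have u1 n : u n <= 1.
  apply: (@le_trans _ _ (\sum_(0 <= t < n.+1) pmf t)); last first.
    by rewrite sum_pmf0 lerBlDr lerDl.
  rewrite big_nat_recr //= ler_wpDr ?pmf_ge0 // /u big_mkcond.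
  by apply: ler_sum => i _; case: ifP => // _; exact: pmf_ge0.
have uc : cvgn u by apply: nondecreasing_is_cvgn => //; exists 1 => _ [n _ <-].
exists (limn u); split => //.
- by move=> n; exact: nondecreasing_cvgn_le.
- by apply: limr_le => //; apply: nearW.
Qed.

Lemma pmf_interval_ge (S : pred nat) m n : (m <= n)%N ->
  (forall t, (m < t <= n)%N -> S t) ->
  f m - f n <= fine (\sum_(t <oo | S t) (pmf t)%:E)%E <= 1.
Proof.
move=> mn Smn; have [l [ul ule l1]] := pmf_series_cvg S.
rewrite (nneseries_EFin ul) /= l1 andbT; apply: le_trans (ule n.+1).
rewrite -sum_pmf // (@big_cat_nat _ _ _ m.+1 0 n.+1) //= ler_wpDl //.
  by apply: sumr_ge0 => i _; exact: pmf_ge0.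
rewrite [leRHS]big_mkcond big_nat_cond [leRHS]big_nat_cond.
apply: ler_sum => t; rewrite andbT => tmn.
by rewrite Smn.
Qed.

Lemma pmf_initial (S : pred nat) n : (forall t, S t = (t <= n)%N) ->
  fine (\sum_(t <oo | S t) (pmf t)%:E)%E = 1 - f n.
Proof.
move=> Sn; rewrite (@nneseries_EFin pmf S (1 - f n)) //.
apply: (@cvg_near_cst); near=> k.
rewrite -sum_pmf0 (@big_cat_nat _ _ _ n.+1 0 k) //=; last by near: k; exact: nbhs_infty_ge.
rewrite [X in _ + X]big_nat_cond [X in _ + X]big1 ?addr0; last first.
  by move=> i /andP[/andP[ni _]]; rewrite Sn leqNgt ni.
rewrite big_mkcond; apply: eq_big_nat => i; rewrite Sn => /andP[_ ltin].
by rewrite -ltnS ltin.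
Unshelve. all: by end_near. Qed.

Lemma pmf_empty (S : pred nat) : (forall t, S t = false) ->
  fine (\sum_(t <oo | S t) (pmf t)%:E)%E = 0.
Proof.
move=> S0; rewrite (@nneseries_EFin pmf S 0) //.
by apply: (@cvg_near_cst); near=> k; rewrite big1 // => i; rewrite S0.
Unshelve. all: by end_near. Qed.

Lemma sum_ge_mul n : n%:R * f n <= \sum_(0 <= u < n) f u.
Proof.
rewrite mulr_natl -(subn0 n) -sumr_const_nat subn0 big_nat_cond [leRHS]big_nat_cond.
by apply: ler_sum => i /andP[/andP[_ ltin] _]; apply: nonincreasing_le; exact: ltnW.
Qed.

Section Mean.
Variable B : R.
Hypothesis sumB : forall n, \sum_(0 <= u < n) f u <= B.

Lemma sum_survival_cvg : exists T : R, [/\ \sum_(0 <= u < n) f u @[n --> \oo] --> T,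
  (forall n, \sum_(0 <= u < n) f u <= T) & T <= B].
Proof.
set u := fun n => \sum_(0 <= i < n) f i.
have u_nd : nondecreasing_seq u.
  by apply/nondecreasing_seqP => n; rewrite /u big_nat_recr //= lerDl.
have uc : cvgn u by apply: nondecreasing_is_cvgn => //; exists B => _ [n _ <-]; exact: sumB.
exists (limn u); split => //.
- by move=> n; exact: nondecreasing_cvgn_le.
- by apply: limr_le => //; apply: nearW; exact: sumB.
Qed.

Lemma survival_cvg0 : f n @[n --> \oo] --> (0 : R).
Proof.
have [T [cT _ _]] := sum_survival_cvg.
exact: (@cvg_series_cvg_0 _ _ f) (cvgP _ cT).
Qed.

Lemma sum_tpmf n : \sum_(0 <= t < n.+1) t%:R * pmf t = \sum_(0 <= u < n) f u - n%:R * f n.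
Proof.
elim: n => [|n IH]; first by rewrite big_nat1 big_geq // !mul0r subr0.
rewrite big_nat_recr //= IH [in RHS]big_nat_recr //= -natr1; ring.
Qed.

(** Abel summation leaves the boundary term [n * f n], which the tail absorbs: the sum of [f] from
    [k] to [n] is at least [(n - k) * f n], so the partial means are at least the sum of [f] up to
    [k] minus [k * f n]. With [k] fixed, [f n] tends to 0. *)
Lemma mean_series (T : R) : \sum_(0 <= u < n) f u @[n --> \oo] --> T ->
  (\sum_(t <oo) (t%:R * pmf t)%:E)%E = T%:E.
Proof.
move=> cT; apply: (@nneseries_EFin _ xpredT).
set a := fun n => \sum_(0 <= t < n) t%:R * pmf t.
have a_nd : nondecreasing_seq a.
  apply/nondecreasing_seqP => n; rewrite /a big_nat_recr //= lerDl.
  by rewrite mulr_ge0 // pmf_ge0.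
have leT n : \sum_(0 <= u < n) f u <= T.
  rewrite -(cvg_lim _ cT) //; apply: nondecreasing_cvgn_le; last exact: cvgP cT.
  by apply/nondecreasing_seqP => k; rewrite [leRHS]big_nat_recr //= lerDl.
have a_le n : a n <= T.
  case: n => [|n]; first by apply: le_trans (leT 0%N); rewrite /a !big_geq.
  by rewrite /a sum_tpmf (le_trans _ (leT n)) // gerBl mulr_ge0.
have ac : cvgn a by apply: nondecreasing_is_cvgn => //; exists T => _ [n _ <-].
suff -> : T = limn a by [].
apply/eqP; rewrite eq_le; apply/andP; split; last first.
  by apply: limr_le => //; apply: nearW.
rewrite -(cvg_lim _ cT) //; apply: limr_le; first exact: cvgP cT.
apply: nearW => k.
have Sk : \sum_(0 <= u < k) f u - k%:R * f n @[n --> \oo] --> \sum_(0 <= u < k) f u.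
  rewrite -[X in _ --> X]subr0; apply: cvgB; first exact: cvg_cst.
  rewrite -(mulr0 k%:R); apply: cvgM; first exact: cvg_cst.
  exact: survival_cvg0.
have ac' : a n.+1 @[n --> \oo] --> limn a by rewrite (cvg_shiftS a).
rewrite -(cvg_lim _ Sk) // -(cvg_lim _ ac') //.
apply: ler_lim; [exact: cvgP Sk | exact: cvgP ac' |].
near=> n; have kn : (k <= n)%N by near: n; exact: nbhs_infty_ge.
rewrite /a sum_tpmf (@big_cat_nat _ _ _ k 0 n) //=.
have : (n - k)%:R * f n <= \sum_(k <= u < n) f u.
  rewrite mulr_natl -sumr_const_nat big_nat_cond [leRHS]big_nat_cond.
  by apply: ler_sum => i /andP[/andP[_ ltin] _]; apply: nonincreasing_le; exact: ltnW.
by rewrite natrB // mulrBl; lra.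
Unshelve. all: by end_near. Qed.

Lemma pmf_series1 : (\sum_(t <oo) (pmf t)%:E)%E = 1%E.
Proof.
apply: (@nneseries_EFin _ xpredT).
rewrite -(cvg_shiftS (fun n => \sum_(0 <= t < n) pmf t)).
under eq_fun do rewrite sum_pmf0.
suff: 1 - f n @[n --> \oo] --> (1 - 0 : R) by rewrite subr0.
by apply: cvgB; [exact: cvg_cst | exact: survival_cvg0].
Qed.
End Mean.
End HittingTimeLaw.

(** Up to time [z = 1 / (2 c)] survival is at least one half, and more than [z] terms are summed. *)
Lemma sum_ge_of_escape (R : realType) (f : nat -> R) (c : R) : 0 < c ->
  (forall n : nat, 1 - f n <= n%:R * c) ->
  exists n, (4 * c)^-1 <= \sum_(0 <= u < n) f u.
Proof.
move=> c0 fc; pose z := (2 * c)^-1.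
have z0 : 0 < z by rewrite invr_gt0 mulr_gt0.
have cz : z * c = 2^-1 by rewrite /z; field; lra.
exists (Num.truncn z).+1.
apply: (@le_trans _ _ (\sum_(0 <= u < (Num.truncn z).+1) (2^-1 : R))).
  rewrite sumr_const_nat subn0 -[leRHS]mulr_natl.
  have -> : (4 * c)^-1 = z * 2^-1 by rewrite /z; field; lra.
  by rewrite ler_wpM2r ?invr_ge0 // ltW // truncnS_gt.
rewrite big_nat_cond [leRHS]big_nat_cond; apply: ler_sum => u.
rewrite andbT ltnS => /= utr.
have uz : u%:R <= z by rewrite -truncn_ge_nat // ltW.
have := fc u; have := ler_wpM2r (ltW c0) uz; rewrite cz; lra.
Qed.

(** * From survival estimates uniform in beta to the three limits *)

Section SurvivalAsymptotics.
Variables (R : realType) (g : grid_kind) (K L : nat) (x y : config K L).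
Local Open Scope classical_set_scope.
Let f (beta : R) t := surv g beta y t x.

Hypothesis f_ge0 : forall beta n, 0 < beta -> 0 <= f beta n.
Hypothesis f_leS : forall beta n, 0 < beta -> f beta n.+1 <= f beta n.
Variables (Gam C delta : R).
Hypotheses (C_ge1 : 1 <= C) (delta_gt0 : 0 < delta) (Gam_gt0 : 0 < Gam).
Hypothesis sum_le : forall beta n, 0 < beta ->
  \sum_(0 <= u < n) f beta u <= C * expR (beta * Gam).
Hypothesis escape_bound : forall beta n, 0 < beta ->
  1 - f beta n <= n%:R * (C * expR (- (beta * Gam))).
Hypothesis close : forall (beta T : R), 0 < beta ->
  \sum_(0 <= u < n) f beta u @[n --> \oo] --> T ->
  forall n : nat,
  `|f beta n - (1 - T^-1) ^+ n| <= C * expR (- (beta * delta)) * (1 + n%:R / T).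

Lemma C_gt0 : 0 < C. Proof. exact: lt_le_trans ltr01 C_ge1. Qed.

Let hit beta (S : pred nat) : hit_prob g beta x y S =
  fine (\sum_(t <oo | S t)
    (if t is t'.+1 then f beta t' - f beta t else 0)%:E)%E.
Proof. by []. Qed.

Lemma sum_survival_ge beta : 0 < beta ->
  exists n, (4 * C)^-1 * expR (beta * Gam) <= \sum_(0 <= u < n) f beta u.
Proof.
move=> b0; have c0 : 0 < C * expR (- (beta * Gam)) by rewrite mulr_gt0 ?C_gt0 ?expR_gt0.
have [n h] := sum_ge_of_escape c0 (fun n => escape_bound n b0); exists n.
by move: h; rewrite expRN mulrA invfM invrK.
Qed.

Lemma hit_mean_spec beta : 0 < beta ->
  exists T : R, [/\ hit_mean g beta x y = T%:E,
    \sum_(0 <= u < n) f beta u @[n --> \oo] --> T,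
    (forall n : nat, \sum_(0 <= u < n) f beta u <= T),
    T <= C * expR (beta * Gam) &
    (4 * C)^-1 * expR (beta * Gam) <= T /\ 1 <= T].
Proof.
move=> b0; have [T [cT leT TB]] := sum_survival_cvg (fun n => f_ge0 n b0)
  (fun n => sum_le n b0).
exists T; split => //.
- rewrite /hit_mean.
  have -> : (\sum_(t <oo) ((hit_pmf g beta x y t)%:E))%E = 1%E.
    exact: (pmf_series1 (f := f beta) erefl (fun n => f_ge0 n b0) (fun n => sum_le n b0)).
  rewrite eqxx.
  exact: (mean_series (f := f beta) (fun n => f_ge0 n b0)
    (fun n => f_leS n b0) (fun n => sum_le n b0) cT).
- split; last by have := leT 1%N; rewrite big_nat1.
  by have [n /le_trans->] := sum_survival_ge b0.
Qed.

Lemma expR_decay (a : R) : 0 < a -> expR (- (beta * a)) @[beta --> +oo] --> (0 : R).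
Proof.
move=> a0; under eq_fun do rewrite mulrC.
apply: (@cvg_comp _ _ _ (fun b => a * b) (fun z => expR (- z)) _ _ _ _ (@cvgr_expR R)).
by apply: gt0_cvgMry => //; exact: cvg_id.
Qed.

Lemma inv_cvg0 (c : R) : c / beta @[beta --> +oo] --> (0 : R).
Proof.
rewrite -(mulr0 c); apply: cvgM; first exact: cvg_cst.
by apply/gtr0_cvgV0; [exact: nbhs_pinfty_gt | exact: cvg_id].
Qed.

Lemma hit_window (eps : R) : 0 < eps ->
  hit_prob g beta x y
     (fun t => (expR (beta * (Gam - eps)) < t%:R) && (t%:R < expR (beta * (Gam + eps))))
     @[beta --> +oo] --> (1 : R).
Proof.
move=> e0.
apply: (@squeeze_cvgr _ _ _ _ (fun beta => 1 - 3 * C * expR (- (beta * eps))) (fun=> 1)).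
- near=> beta; have b0 : 0 < beta by near: beta; exact: nbhs_pinfty_gt.
  set a := expR (beta * (Gam - eps)); set b := expR (beta * (Gam + eps)).
  (* Times up to [n2] must stay strictly below [b], hence the half. It doubles the constant in the
     Markov bound at [n2]; with the escape bound at [n1] this makes the factor 3. *)
  set n1 := Num.truncn a; set n2 := Num.truncn (b / 2).
  have a0 : 0 < a by exact: expR_gt0.
  have bpos : 0 < b by exact: expR_gt0.
  have f1 n : f beta n <= 1.
    by elim: n => [|n IH] //; apply: le_trans (f_leS _ b0) IH.
  have fn1 : 1 - C * expR (- (beta * eps)) <= f beta n1.
    have := escape_bound n1 b0.
    have : n1%:R * (C * expR (- (beta * Gam))) <= a * (C * expR (- (beta * Gam))).
      by rewrite ler_wpM2r ?truncn_le ?mulr_ge0 ?expR_ge0 ?(ltW C_gt0) // ltW.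
    have -> : a * (C * expR (- (beta * Gam))) = C * expR (- (beta * eps)).
      by rewrite mulrCA /a -expRD; congr (_ * expR _); ring.
    lra.
  have fn2 : f beta n2 <= 2 * C * expR (- (beta * eps)).
    have := sum_ge_mul (fun n => f_leS n b0) n2.+1.
    have := sum_le n2.+1 b0.
    have b2 : b / 2 <= n2.+1%:R by rewrite ltW // truncnS_gt.
    rewrite big_nat_recr //= => S1 S2.
    have h1 : b / 2 * f beta n2 <= C * expR (beta * Gam).
      have h2 := ler_wpM2r (f_ge0 n2 b0) b2; have h3 := sum_ge_mul (fun n => f_leS n b0) n2.
      by apply: le_trans h2 _; rewrite -natr1 mulrDl mul1r; lra.
    have -> : 2 * C * expR (- (beta * eps)) = 2 * (C * expR (beta * Gam)) / b.
      rewrite -!mulrA /b -expRN -expRD; congr (_ * (_ * expR _)); ring.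
    by rewrite ler_pdivlMr // mulrC; lra.
  (* For small [beta] the two times may come in the wrong order; the lower bound to prove is then
     not positive. *)
  have n12 : (n1 <= n2)%N \/ f beta n1 - f beta n2 <= 0.
    have [|/ltnW lt21] := leqP n1 n2; first by left.
    by right; rewrite subr_le0; exact: nonincreasing_le (fun n => f_leS n b0) _ _ lt21.
  rewrite hit; case: n12 => [le12|neg].
  + have sub t : (n1 < t <= n2)%N -> (a < t%:R) && (t%:R < b).
      move=> /andP[n1t tn2]; rewrite (lt_le_trans (truncnS_gt a)) ?ler_nat //=.
      apply: le_lt_trans (_ : b / 2 < b); last by lra.
      by rewrite (le_trans _ (_ : n2%:R <= _)) ?ler_nat // truncn_le; lra.
    have /andP[h1 ->] := pmf_interval_ge (f := f beta) erefl (fun n => f_ge0 n b0)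
      (fun n => f_leS n b0) le12 sub.
    by rewrite andbT (le_trans _ h1) //; lra.
  + have [l [ul ule l1]] := pmf_series_cvg (f := f beta) erefl (fun n => f_ge0 n b0)
      (fun n => f_leS n b0) (fun t => (a < t%:R) && (t%:R < b)).
    rewrite (nneseries_EFin ul) /= l1 andbT (le_trans _ (ule 0%N)) // big_geq //.
    by lra.
- rewrite -[X in _ --> X]subr0; apply: cvgB; first exact: cvg_cst.
  rewrite -(mulr0 (3 * C)); apply: cvgM; first exact: cvg_cst.
  exact: expR_decay.
- exact: cvg_cst.
Unshelve. all: by end_near. Qed.

Lemma log_mean_cvg :
  ln (fine (hit_mean g beta x y)) / beta @[beta --> +oo] --> Gam.
Proof.
apply: (@squeeze_cvgr _ _ _ _ (fun beta => Gam - ln (4 * C) / beta)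
  (fun beta => Gam + ln C / beta)).
- near=> beta; have b0 : 0 < beta by near: beta; exact: nbhs_pinfty_gt.
  have [T [-> _ _ Tle [Tge _]]] := hit_mean_spec b0; rewrite /=.
  have c0 := C_gt0; have e0 := expR_gt0 (beta * Gam).
  have T0 : 0 < T by apply: lt_le_trans Tge; rewrite mulr_gt0 ?invr_gt0 //; lra.
  have lnE z : 0 < z -> ln (z * expR (beta * Gam)) = ln z + beta * Gam.
    by move=> z0; rewrite lnM ?posrE // expRK.
  rewrite ler_pdivlMr // ler_pdivrMr // [(Gam - _) * _]mulrBl [(Gam + _) * _]mulrDl.
  rewrite !divfK ?gt_eqF //.
  rewrite [Gam * _]mulrC; apply/andP; split.
    rewrite addrC -lnV ?posrE ?mulr_gt0 // -lnE ?invr_gt0 ?mulr_gt0 //.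
    by rewrite ler_ln ?posrE // mulr_gt0 ?invr_gt0 ?mulr_gt0.
  by rewrite addrC -lnE // ler_ln ?posrE // mulr_gt0.
- rewrite -[X in _ --> X]subr0; apply: cvgB; first exact: cvg_cst.
  exact: inv_cvg0.
- rewrite -[X in _ --> X]addr0; apply: cvgD; first exact: cvg_cst.
  exact: inv_cvg0.
Unshelve. all: by end_near. Qed.

Lemma expR_inv_le (r : R) n : 0 <= r < 1 -> 
  expR (- (n%:R * r / (1 - r))) <= (1 - r) ^+ n <= expR (- (n%:R * r)).
Proof.
move=> /andP[r0 r1]; have q0 : 0 < 1 - r by lra.
have -> : - (n%:R * r / (1 - r)) = n%:R * (- (r / (1 - r))) by ring.
rewrite -[- (n%:R * r)]mulrN !expRM_natl.
apply/andP; split; apply: lerXn2r; rewrite ?nnegrE ?expR_ge0 ?(ltW q0) //; last first.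
  exact: expR_ge1Dx.
rewrite expRN -[leRHS]invrK lef_pV2 ?posrE ?expR_gt0 ?invr_gt0 //.
rewrite [leLHS](_ : _ = 1 + r / (1 - r)); first exact: expR_ge1Dx.
by field; lra.
Qed.

Lemma scaled_hitting_cvg (s : R) :
  hit_prob g beta x y (fun t => t%:R <= s * fine (hit_mean g beta x y))
          @[beta --> +oo] --> exp1_cdf s.
Proof.
have mean_ge1 (beta : R) : 0 < beta -> 1 <= fine (hit_mean g beta x y).
  by move=> b0; have [T [-> _ _ _ [_ T1]]] := hit_mean_spec b0.
rewrite /exp1_cdf; case: ltP => [s0|s0].
  apply: (@cvg_near_cst); near=> beta.
  have b0 : 0 < beta by near: beta; exact: nbhs_pinfty_gt.
  rewrite hit; apply: pmf_empty => t; apply/negbTE; rewrite -ltNge.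
  by apply: (@lt_le_trans _ _ 0) => //; have := mean_ge1 _ b0; nra.
pose r (beta : R) := (fine (hit_mean g beta x y))^-1.
have r0 : r beta @[beta --> +oo] --> (0 : R).
  apply: (@squeeze_cvgr _ _ _ _ (fun=> 0) (fun beta => 4 * C * expR (- (beta * Gam)))).
  - near=> beta; have b0 : 0 < beta by near: beta; exact: nbhs_pinfty_gt.
    have [T [TE _ _ _ [Tge T1]]] := hit_mean_spec b0; rewrite /r TE /=.
    rewrite invr_ge0 (le_trans ler01 T1) /= -[leRHS]invrK lef_pV2 ?posrE.
    + by rewrite invfM expRN invrK.
    + exact: lt_le_trans T1.
    + by rewrite invr_gt0 !mulr_gt0 ?C_gt0 ?expR_gt0.
  - exact: cvg_cst.
  - rewrite -(mulr0 (4 * C)); apply: cvgM; first exact: cvg_cst.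
    exact: expR_decay.
(* Rounding [s * T] down loses less than one step, that is [1 / T] on the scale of the mean; this is
   the [r beta] added to [- s]. *)
have bounds beta : 0 < beta -> r beta < 1 ->
    1 - expR (- s + r beta) - C * expR (- (beta * delta)) * (1 + s) <=
    hit_prob g beta x y (fun t => t%:R <= s * fine (hit_mean g beta x y)) <=
    1 - expR (- (s / (1 - r beta))) + C * expR (- (beta * delta)) * (1 + s).
  move=> b0 r1; have [T [TE cT _ _ [_ T1]]] := hit_mean_spec b0.
  have T0 : 0 < T by exact: lt_le_trans T1.
  have sT0 : 0 <= s * T by rewrite mulr_ge0 // ltW.
  rewrite /r TE /= in r1 *; rewrite hit.
  set m := Num.truncn (s * T).
  rewrite (@pmf_initial _ (f beta) erefl _ m); last first.
    by move=> t; rewrite -truncn_ge_nat.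
  have mr : m%:R * T^-1 <= s by rewrite ler_pdivrMr // truncn_le.
  have mr' : s - T^-1 <= m%:R * T^-1.
    rewrite lerBlDr -{2}[T^-1]mul1r -mulrDl natr1 ler_pdivlMr // ltW //.
    exact: truncnS_gt.
  have rT : 0 <= T^-1 < 1 by rewrite invr_ge0 (ltW T0).
  have /andP[lo hi] := expR_inv_le m rT.
  have := close b0 cT m; rewrite ler_distl => /andP[c1 c2].
  have c3 : C * expR (- (beta * delta)) * (1 + m%:R / T) <= C * expR (- (beta * delta)) * (1 + s).
    by rewrite ler_wpM2l ?lerD2l // mulr_ge0 ?expR_ge0 // ltW // C_gt0.
  have hi' : expR (- (m%:R * T^-1)) <= expR (- s + T^-1) by rewrite ler_expR; lra.
  have lo' : expR (- (s / (1 - T^-1))) <= expR (- (m%:R * T^-1 / (1 - T^-1))).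
    rewrite ler_expR lerN2 ler_wpM2r // invr_ge0; lra.
  apply/andP; split; lra.
have err : C * expR (- (beta * delta)) * (1 + s) @[beta --> +oo] --> (0 : R).
  rewrite -(mul0r (1 + s)); apply: cvgM; last exact: cvg_cst.
  rewrite -(mulr0 C); apply: cvgM; [exact: cvg_cst | exact: expR_decay].
apply: (@squeeze_cvgr _ _ _ _
   (fun beta => 1 - expR (- s + r beta) - C * expR (- (beta * delta)) * (1 + s))
   (fun beta => 1 - expR (- (s / (1 - r beta))) + C * expR (- (beta * delta)) * (1 + s))).
- near=> beta; apply: bounds; near: beta; first exact: nbhs_pinfty_gt.
  exact: (cvgr_lt 0 r0).
- rewrite -[X in _ --> X]subr0; apply: cvgB => //.
  apply: cvgB; first exact: cvg_cst.
  apply: (@cvg_comp _ _ _ (fun b => - s + r b) expR _ (nbhs (- s + 0))).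
    by apply: cvgD => //; exact: cvg_cst.
  by rewrite addr0; exact: continuous_expR.
- rewrite -[X in _ --> X]addr0; apply: cvgD => //.
  apply: cvgB; first exact: cvg_cst.
  apply: (@cvg_comp _ _ _ (fun b => - (s / (1 - r b))) expR _ (nbhs (- (s / (1 - 0))))).
    apply: cvgN; apply: cvgM; first exact: cvg_cst.
    apply: cvgV; first by rewrite subr0 oner_neq0.
    by apply: cvgB => //; exact: cvg_cst.
  by rewrite subr0 divr1; exact: continuous_expR.
Unshelve. all: by end_near. Qed.

Lemma hitting_asymptotics_of_survival : hitting_asymptotics g x y Gam.
Proof. by split; [exact: hit_window | split; [exact: log_mean_cvg | exact: scaled_hitting_cvg]]. Qed.

End SurvivalAsymptotics.

(** * Single-site moves on a bipartite graph *)

Section HardCoreGraph.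
Variables (T : finType) (e : rel T).
Notation conf := {ffun T -> bool}.
Implicit Types (s : conf) (v w : T).

Definition npart s : nat := #|[pred v | s v]|.

Definition flip s v : conf := [ffun w => if w == v then ~~ s w else s w].

Definition independent s : bool :=
  [forall v, forall w, e v w ==> ~~ (s v && s w)].

(* Single-site updates among the hard-core configurations with at least [m] particles,
   i.e. of energy at most [- m]. *)
Definition move (m : nat) : rel conf := fun s s' =>
  [&& independent s, independent s', #|[pred v | s v != s' v]| == 1%N,
      (m <= npart s)%N & (m <= npart s')%N].

Lemma independentP s : reflect (forall v w, e v w -> s v -> s w -> False) (independent s).
Proof.
apply: (iffP forallP) => [h v w evw sv sw|h v].
  by have /forallP/(_ w) := h v; rewrite evw sv sw.
by apply/forallP => w; apply/implyP => evw; apply/negP => /andP[sv sw]; apply: h evw sv sw.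
Qed.

Lemma diff1P s s' : reflect (exists v, s' = flip s v) (#|[pred v | s v != s' v]| == 1%N).
Proof.
apply: (iffP card1P) => -[v E]; exists v.
  apply/ffunP => w; rewrite ffunE; have := E w; rewrite !inE.
  by case: (w == v); case: (s w); case: (s' w).
move=> w; rewrite !inE E ffunE; case: (w == v); last by rewrite eqxx.
by case: (s w).
Qed.

Lemma npart_flip s v : npart (flip s v) = if s v then (npart s).-1 else (npart s).+1.
Proof.
rewrite /npart (cardD1 v) [in RHS](cardD1 v) !inE !ffunE eqxx.
rewrite (eq_card (B := [predD1 [pred w | s w] & v])); last first.
  by move=> w; rewrite !inE ffunE; case: (w == v).
by case: (s v).
Qed.

Lemma move_flip m s v : independent s -> independent (flip s v) ->
  (m <= npart s)%N -> (m <= npart (flip s v))%N -> move m s (flip s v).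
Proof.
by move=> is1 is2 m1 m2; rewrite /move is1 is2 m1 m2 !andbT /=; apply/diff1P; exists v.
Qed.

Lemma move_sym m : symmetric (move m).
Proof.
move=> s s'; rewrite /move andbCA; congr [&& _, _ & _]; rewrite [(m <= npart s')%N && _]andbC.
by congr (_ && _); congr (_ == _); apply: eq_card => v; rewrite !inE eq_sym.
Qed.

Lemma connect_move_le a b s t : (a <= b)%N -> connect (move b) s t -> connect (move a) s t.
Proof.
move=> ab; apply: connect_sub => u v /and5P[fu fv d1 bu bv]; apply: connect1.
by rewrite /move fu fv d1 (leq_trans ab bu) (leq_trans ab bv).
Qed.

Lemma independent_sub s s' : (forall v, s' v -> s v) -> independent s -> independent s'.
Proof.
move=> sub /independentP h; apply/independentP => v w evw sv sw.
exact: h evw (sub _ sv) (sub _ sw).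
Qed.

Lemma independent_add s v : ~~ e v v -> symmetric e -> independent s ->
  (forall w, e v w -> ~~ s w) -> independent (flip s v).
Proof.
move=> nvv esym /independentP h nb; apply/independentP => a b eab.
rewrite !ffunE; case: eqVneq => [av|_]; case: eqVneq => [bv|_].
- by move: nvv; rewrite -{1}av -bv eab.
- by rewrite av in eab; move=> _ sb; move: (nb _ eab); rewrite sb.
- by rewrite bv esym in eab; move=> sa; move: (nb _ eab); rewrite sa.
- exact: h eab.
Qed.

Definition remove s (A : pred T) : conf := [ffun v => s v && ~~ A v].

Lemma npart_remove s (A : pred T) :
  (npart (remove s A) + #|[pred v | s v && A v]| = npart s)%N.
Proof.
rewrite addnC /npart -[RHS](cardID A); congr (_ + _)%N; apply: eq_card => v.
by rewrite !inE ffunE andbC.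
Qed.

Lemma connect_remove s (A : pred T) : independent s ->
  connect (move (npart (remove s A))) s (remove s A).
Proof.
have [n] := ubnP #|[pred v | s v && A v]|; elim: n s => // n IH s le_n is1.
have [/existsP[v /andP[sv Av]]|none] := boolP [exists v, s v && A v]; last first.
  rewrite (_ : remove s A = s) ?connect0 //; apply/ffunP => v; rewrite ffunE.
  have /existsPn/(_ v) := none; by case: (s v) => //= ->.
have is2 : independent (flip s v).
  by apply: independent_sub is1 => w; rewrite ffunE; case: eqVneq => // ->; rewrite sv.
have remE : remove (flip s v) A = remove s A.
  by apply/ffunP => w; rewrite !ffunE; case: eqVneq => // ->; rewrite Av !andbF.
have := IH (flip s v); rewrite remE; move=> /(_ _ is2) h.
apply: (connect_trans (y := flip s v)); last first.
  apply: h; rewrite (leq_trans _ (_ : #|[pred v | s v && A v]| <= n)%N) //.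
  rewrite [ltnRHS](cardD1 v) !inE sv Av /= ltnS; apply/subset_leq_card/fintype.subsetP => w.
  by rewrite !inE ffunE; case: eqVneq => [->|]; rewrite ?sv.
apply: connect1; apply: move_flip => //.
  by rewrite -(npart_remove s A) leq_addr.
by rewrite -(npart_remove (flip s v) A) remE leq_addr.
Qed.

Variable par : T -> bool.
Hypothesis esym : symmetric e.
Hypothesis epar : forall v w, e v w -> par v != par w.

Lemma eirr v : ~~ e v v.
Proof. by apply/negP => /epar; rewrite eqxx. Qed.

Definition fill s w : conf := flip (remove s (e w)) w.

Lemma fillE s w v : ~~ s w -> fill s w v = (v == w) || (s v && ~~ e w v).
Proof. by move=> nsw; rewrite !ffunE; case: eqVneq => // ->; rewrite (negbTE nsw). Qed.

(** The neighbours of [w] leave before [w] is filled, so the path dips by at most [t], but the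
    particle gained at [w] leaves a final loss of only [t - 1]. *)
Lemma fill_spec s w t : independent s -> ~~ s w ->
  (#|[pred v | s v && e w v]| <= t)%N ->
  [/\ independent (fill s w), connect (move (npart s - t)) s (fill s w) &
      ((npart s).+1 <= npart (fill s w) + t)%N].
Proof.
move=> is1 nsw card_t.
have is2 : independent (remove s (e w)).
  by apply: independent_sub is1 => v; rewrite ffunE => /andP[].
have is3 : independent (fill s w).
  apply: independent_add => //; first exact: eirr.
  by move=> v ewv; rewrite ffunE ewv andbF.
have rm := npart_remove s (e w).
have npf : npart (fill s w) = (npart (remove s (e w))).+1.
  by rewrite npart_flip ffunE (negbTE nsw).
split=> //; last by rewrite npf; lia.
apply: (connect_trans (y := remove s (e w))).
  by apply: connect_move_le (connect_remove (e w) is1); lia.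
by apply: connect1; apply: move_flip; rewrite -/(fill s w) ?npf //; lia.
Qed.

Definition pconf (b : bool) : conf := [ffun v => par v == b].

Lemma independent_pconf b : independent (pconf b).
Proof.
apply/independentP => v w /epar; rewrite !ffunE => vw /eqP vb /eqP wb.
by move: vw; rewrite vb wb eqxx.
Qed.

(** * Sweeping from a line to a pure configuration *)

Section Sweep.
Variables (b : bool) (line : pred T) (rank : T -> nat) (t : nat).
Hypothesis has_nb : forall v, exists w, e v w.
Hypothesis t_gt0 : (0 < t)%N.
(* Once all sites of colour [b] of rank below [rank w] are occupied, at most one neighbour of [w]
   can still be occupied, so that filling [w] costs no energy in the end. *)
Hypothesis rank_nb : forall w, par w = b -> ~~ line w ->
  exists u0, forall u, e w u -> u != u0 ->
  exists2 w', e u w' & par w' = b /\ (rank w' < rank w)%N.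
Hypothesis out_nb : forall w, par w = b -> line w ->
  (#|[pred u | e w u && ~~ line u]| <= t)%N.

Lemma complete_pconf s : independent s -> (forall v, par v = b -> s v) -> s = pconf b.
Proof.
move=> is1 sb; apply/ffunP => v; rewrite ffunE.
have [pv|pv] := eqVneq (par v) b; first exact: sb.
have [w evw] := has_nb v; apply/negbTE/negP => sv.
apply: (independentP _ is1 v w evw sv); apply: sb.
by have := epar evw; move: pv; case: (par v); case: (par w); case: b.
Qed.

Lemma fill_b s w : par w = b -> ~~ s w -> forall v, par v = b -> s v -> fill s w v.
Proof.
move=> pw nsw v pv sv; rewrite fillE // sv /=; apply/orP; right.
by apply/negP => /epar; rewrite pw pv eqxx.
Qed.

Lemma sweep_from_line s : independent s -> (forall v, par v = b -> line v -> s v) ->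
  connect (move (npart s - 1)) s (pconf b).
Proof.
have [n] := ubnP #|[pred v | (par v == b) && ~~ s v]|; elim: n s => // n IH s le_n is1 sline.
have [/existsP[v0 v0P]|none] := boolP [exists v, (par v == b) && ~~ s v]; last first.
  rewrite -(complete_pconf is1) ?connect0 // => v /eqP pv.
  by have /existsPn/(_ v) := none; rewrite pv /= negbK.
have [w /andP[/eqP pw nsw] wmin] :=
  @arg_minnP _ v0 (fun v => (par v == b) && ~~ s v) rank v0P.
have nline : ~~ line w by apply: contra nsw; exact: sline.
have [u0 nbP] := rank_nb pw nline.
have c1 : (#|[pred v | s v && e w v]| <= 1)%N.
  rewrite -(card1 u0); apply/subset_leq_card/fintype.subsetP => u; rewrite !inE => /andP[su ewu].
  apply/negPn/negP => /(nbP u ewu)[w' euw' [pw' rk]].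
  have sw' : s w'.
    by apply/negPn/negP => nsw'; have := wmin w'; rewrite pw' eqxx nsw' leqNgt rk => /(_ isT).
  exact: (independentP _ is1 u w' euw' su sw').
have [is2 con npf] := fill_spec is1 nsw c1.
apply: (connect_trans con); apply: connect_move_le (IH (fill s w) _ is2 _).
- lia.
- rewrite (leq_trans _ (_ : #|[pred v | (par v == b) && ~~ s v]| <= n)%N) //.
  rewrite [ltnRHS](cardD1 w) !inE pw nsw eqxx /= ltnS; apply/subset_leq_card/fintype.subsetP => v.
  rewrite !inE => /andP[/eqP pv nf]; rewrite pv eqxx /=; apply/andP; split.
    by apply: contraNneq nf => ->; rewrite fillE // eqxx.
  by apply: contra nf; exact: fill_b.
- by move=> v pv lv; apply: fill_b => //; exact: sline.
Qed.

(** A missing site of the line has no occupied neighbour on the line, so filling it means a lasting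
    loss of at most [t - 1]. The final 1 covers the extra dip during each filling as well as the
    sweep that follows. *)
Lemma sweep_cleared s : independent s -> (forall v, par v != b -> line v -> ~~ s v) ->
  connect (move (npart s - (t.-1 * #|[pred v | [&& par v == b, line v & ~~ s v]]| + 1))) s (pconf b).
Proof.
have [n] := ubnP #|[pred v | [&& par v == b, line v & ~~ s v]]|; elim: n s => // n IH s le_n.
move=> is1 sline; set M := #|_| in le_n *.
have [/existsP[w /and3P[/eqP pw lw nsw]]|none] :=
  boolP [exists v, [&& par v == b, line v & ~~ s v]]; last first.
  apply: connect_move_le (sweep_from_line is1 _); first lia.
  move=> v /eqP pv lv; have /existsPn/(_ v) := none; by rewrite pv lv /= negbK.
have ct : (#|[pred v | s v && e w v]| <= t)%N.
  apply: leq_trans (out_nb pw lw); apply/subset_leq_card/fintype.subsetP => u.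
  rewrite !inE => /andP[su ewu]; rewrite ewu /=; apply/negP => lu.
  have := epar ewu; rewrite pw eq_sym => pu.
  by move: (sline u pu lu); rewrite su.
have [is2 con npf] := fill_spec is1 nsw ct.
have M' : (#|[pred v | [&& par v == b, line v & ~~ fill s w v]]| < M)%N.
  rewrite /M [ltnRHS](cardD1 w) !inE pw lw nsw eqxx /= ltnS.
  apply/subset_leq_card/fintype.subsetP => v.
  rewrite !inE => /and3P[/eqP pv lv nf]; rewrite pv lv eqxx /=; apply/andP; split.
    by apply: contraNneq nf => ->; rewrite fillE // eqxx.
  by apply: contra nf; exact: fill_b.
apply: (connect_trans (y := fill s w)).
  by apply: connect_move_le con; rewrite /M; nia.
apply: connect_move_le (IH (fill s w) _ is2 _).
- move: M'; set M1 := #|_| => M'.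
  have : (t.-1 * M1.+1 <= t.-1 * M)%N by rewrite leq_mul2l M' orbT.
  by rewrite mulnS; lia.
- exact: leq_trans M' _.
- move=> v pv lv; rewrite fillE //; apply/norP; split.
    by apply: contraNneq pv => ->; rewrite pw.
  by rewrite negb_and sline.
Qed.

Lemma sweep s : independent s ->
  connect (move (npart s - (#|[pred v | [&& par v != b, line v & s v]]| +
    t.-1 * #|[pred v | [&& par v == b, line v & ~~ s v]]| + 1))) s (pconf b).
Proof.
move=> is1; pose A := [pred v | (par v != b) && line v].
have rm := npart_remove s A.
have cA : #|[pred v | s v && A v]| = #|[pred v | [&& par v != b, line v & s v]]|.
  by apply: eq_card => v; rewrite !inE andbC andbA.
have cM : #|[pred v | [&& par v == b, line v & ~~ remove s A v]]| =
          #|[pred v | [&& par v == b, line v & ~~ s v]]|.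
  by apply: eq_card => v; rewrite !inE ffunE /=; case: eqP => //=; rewrite andbT.
apply: (connect_trans (y := remove s A)).
  by apply: connect_move_le (connect_remove A is1); lia.
apply: connect_move_le (sweep_cleared (s := remove s A) _ _).
- by rewrite cM; lia.
- by apply: independent_sub is1 => v; rewrite ffunE => /andP[].
- by move=> v pv lv; rewrite ffunE /= pv lv andbF.
Qed.

End Sweep.
End HardCoreGraph.

(** * The Metropolis chain *)

Section Metropolis.
Variables (R : realType) (g : grid_kind) (K L : nat).
Notation conf := (config K L).
Notation move := (move (@adj g K L)).

Lemma card_setb (p : pred (site K L)) : #|[set v | p v]%classic| = #|[pred v | p v]|.
Proof. by apply: eq_card => v; apply/idP/idP; rewrite !inE. Qed.

Lemma ndiffE (s s' : conf) : ndiff s s' = #|[pred v | s v != s' v]|.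
Proof. exact: (card_setb (fun v => s v != s' v)). Qed.

Lemma HamE (s : conf) : Ham R s = - (npart s)%:R.
Proof. by rewrite /Ham (card_setb s). Qed.

Lemma ndiff_sym (s s' : conf) : ndiff s s' = ndiff s' s.
Proof. by rewrite !ndiffE; apply: eq_card => v; rewrite !inE eq_sym. Qed.

Lemma ndiff1P (s s' : conf) : reflect (exists v, s' = flip s v) (ndiff s s' == 1)%N.
Proof. by rewrite ndiffE; exact: diff1P. Qed.

Lemma card_ndiff1 (s : conf) : (#|[pred s' | ndiff s s' == 1]| <= K * L)%N.
Proof.
apply: (@leq_trans #|codom (flip s)|).
  apply/subset_leq_card/fintype.subsetP => s'; rewrite inE => /ndiff1P[v ->].
  exact: codom_f.
by rewrite (leq_trans (card_size _)) // size_codom card_prod !card_ord mulnC.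
Qed.

Variable beta : R.
Hypothesis beta_gt0 : 0 < beta.

(** This form exhibits the conductance: after multiplication by [expR (beta * npart s)] only the
    smaller particle number remains in the exponent, which is symmetric in the two
    configurations. *)
Lemma PoffE (s s' : conf) : Poff g beta s s' =
  if feasible g s' && (ndiff s s' == 1)%N
  then ((K * L)%:R)^-1 * expR (beta * (minn (npart s) (npart s'))%:R - beta * (npart s)%:R)
  else 0.
Proof.
rewrite /Poff; case: ifP => // _; congr (_ * expR _); rewrite !HamE.
rewrite opprK addrC -mulrBr mulNr -mulrN; congr (_ * _).
case: (leqP (npart s) (npart s')) => h.
  have h' : (npart s)%:R <= (npart s')%:R :> R by rewrite ler_nat.
  by rewrite subrr max_l ?oppr0 // subr_le0.
have h' : (npart s')%:R <= (npart s)%:R :> R by rewrite ler_nat ltnW.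
by rewrite max_r ?opprB // subr_ge0.
Qed.

Lemma Poff_ge0 (s s' : conf) : 0 <= Poff g beta s s'.
Proof. by rewrite PoffE; case: ifP => // _; rewrite mulr_ge0 ?invr_ge0 ?expR_ge0. Qed.

Lemma sum_Poff_le1 (s : conf) : \sum_(e : conf | e != s) Poff g beta s e <= 1.
Proof.
apply: (@le_trans _ _ (\sum_(e | ndiff s e == 1%N) ((K * L)%:R)^-1)).
  rewrite big_mkcond [leRHS]big_mkcond; apply: ler_sum => e _.
  rewrite PoffE; case: (ndiff s e == 1)%N; last by rewrite andbF; case: ifP.
  case: ifP => _; rewrite ?invr_ge0 //; case: ifP => _; rewrite ?invr_ge0 //.
  rewrite ler_piMr ?invr_ge0 // -[leRHS]expR0 ler_expR subr_le0 ler_pM2l //.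
  by rewrite ler_nat geq_minl.
rewrite sumr_const -[leLHS]mulr_natr; have := card_ndiff1 s.
have [->|KL0 cle] := eqVneq (K * L)%N 0%N; first by rewrite invr0 mul0r.
by rewrite mulrC ler_pdivrMr ?mul1r ?ler_nat // ltr0n lt0n.
Qed.

(** An infeasible configuration can move to a feasible one but never back, so reversibility holds
    only among the feasible configurations, a set that the chain does not leave. *)
Local Notation fstate := {s : conf | feasible g s}.
Definition Pf (u v : fstate) : R := Pbeta g beta (val u) (val v).
Definition weight (u : fstate) : R := expR (beta * (npart (val u))%:R).

Lemma Pf_ge0 u v : 0 <= Pf u v.
Proof.
rewrite /Pf /Pbeta; case: ifP => _; last exact: Poff_ge0.
by rewrite subr_ge0 sum_Poff_le1.
Qed.

Lemma Pbeta_infeasible (u : fstate) (s : conf) : ~~ feasible g s -> Pbeta g beta (val u) s = 0.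
Proof.
move=> nf; rewrite /Pbeta ifN; first by rewrite /Poff (negbTE nf).
by apply: contraNneq nf => <-; exact: valP u.
Qed.

Lemma sum_fstate (u : fstate) (F : conf -> R) :
  \sum_(s : conf) Pbeta g beta (val u) s * F s = \sum_(v : fstate) Pf u v * F (val v).
Proof.
rewrite (bigID (@feasible g K L)) /= [X in _ + X]big1 ?addr0; last first.
  by move=> s nf; rewrite Pbeta_infeasible ?mul0r.
by rewrite big_sub.
Qed.

Lemma Pf_sum1 u : \sum_v Pf u v = 1.
Proof.
transitivity (\sum_(v : fstate) Pf u v * 1); first by apply: eq_bigr => v _; rewrite mulr1.
rewrite -(sum_fstate u (fun=> 1)); under eq_bigr do rewrite mulr1.
rewrite (bigD1 (val u)) //= {1}/Pbeta eqxx.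
rewrite [X in _ + X](eq_bigr (Poff g beta (val u))) ?subrK // => s.
by rewrite /Pbeta eq_sym => /negbTE ->.
Qed.

Lemma weight_gt0 u : 0 < weight u. Proof. exact: expR_gt0. Qed.

Lemma weight_Pf (u v : fstate) : u != v -> weight u * Pf u v =
  if (ndiff (val u) (val v) == 1)%N
  then ((K * L)%:R)^-1 * expR (beta * (minn (npart (val u)) (npart (val v)))%:R) else 0.
Proof.
move=> uv; rewrite /Pf /Pbeta (inj_eq val_inj) (negbTE uv) PoffE (valP v) /=.
case: ifP => _; last by rewrite mulr0.
by rewrite mulrCA -expRD addrC subrK.
Qed.

Lemma Pf_rev u v : weight u * Pf u v = weight v * Pf v u.
Proof.
have [->//|uv] := eqVneq u v.
have vu : v != u by rewrite eq_sym.
by rewrite weight_Pf // weight_Pf // ndiff_sym minnC.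
Qed.

Lemma survE (y u : fstate) t : surv g beta (val y) t (val u) = survival Pf (pred1 y) t u.
Proof.
elim: t u => [//|t IH] u; rewrite survivalS /=.
rewrite (sum_fstate u (fun z => if z == val y then 0 else surv g beta (val y) t z)).
rewrite [RHS]big_mkcond; apply: eq_bigr => v _ /=.
by rewrite (inj_eq val_inj); case: ifP; rewrite /= ?mulr0 // IH.
Qed.

Lemma connect_fstate m (u v : fstate) : connect (move m) (val u) (val v) ->
  connect (fun a b : fstate => move m (val a) (val b)) u v.
Proof.
move=> /connectP[p]; elim: p u => [|s p IH] u /=.
  by move=> _ /val_inj ->; exact: connect0.
move=> /andP[mv ps] lst; have fs : feasible g s by case/and5P: mv.
have := IH (Sub s fs) ps lst; apply: connect_trans.
by apply: connect1.
Qed.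

Hypothesis KL_gt0 : (0 < K * L)%N.
Notation N := ((K * L)%:R : R).

Lemma N_gt0 : 0 < N. Proof. by rewrite ltr0n. Qed.

(** Along the path every conductance is at least [expR (beta * (npart z - d)) / N], against the
    weight [expR (beta * npart z)] of [z]; the ratio is at most [N * expR (beta * d)], also when the
    subtraction truncates. *)
Lemma green_fstate (A : pred fstate) n d (z a : fstate) : A a ->
  connect (move (npart (val z) - d)) (val z) (val a) ->
  green Pf A n z z <= #|{: fstate}|%:R ^+ 2 * N * expR (beta * d%:R).
Proof.
move=> Aa /connect_fstate cza.
pose kap := N^-1 * expR (beta * (npart (val z) - d)%:R).
have kap0 : 0 < kap by rewrite mulr_gt0 ?invr_gt0 ?N_gt0 ?expR_gt0.
have ekap (u v : fstate) : move (npart (val z) - d) (val u) (val v) -> kap <= weight u * Pf u v.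
  case/and5P=> _ _ uv1 mu mv.
  have uv : u != v.
    apply: contraTneq uv1 => ->; rewrite (eq_card0 (A := [pred _ | _])) // => w.
    by rewrite !inE eqxx.
  rewrite weight_Pf // ndiffE uv1 ler_wpM2l ?invr_ge0 // ler_expR ler_pM2l // ler_nat.
  by rewrite leq_min mu.
apply: le_trans (green_diag_le Pf_ge0 Pf_sum1 weight_gt0 Pf_rev n kap0 Aa ekap cza) _.
rewrite -[leLHS]mulrA -[leRHS]mulrA; apply: ler_wpM2l; first exact: exprn_ge0.
rewrite /kap invfM invrK mulrCA ler_wpM2l ?(ltW N_gt0) //.
rewrite /weight -expRN -expRD ler_expR -mulrBr ler_pM2l // lerBlDr -natrD ler_nat.
by rewrite -leq_subLR.
Qed.

End Metropolis.

(** * Metastable transition between two configurations *)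

Section Metastability.
Variables (R : realType) (g : grid_kind) (K L : nat) (x y : config K L) (m D : nat).
Hypotheses (fx : feasible g x) (fy : feasible g y) (xy : x != y).
Hypothesis KL_gt0 : (0 < K * L)%N.
Hypothesis saddle : connect (move (@adj g K L) m) x y.
Hypothesis saddle_opt : ~~ connect (move (@adj g K L) m.+1) x y.
Hypothesis D_lt : (D < npart x - m)%N.
Hypothesis x_ground : forall z, feasible g z -> z != y -> (npart z <= npart x)%N.
Hypothesis shallow : forall z, feasible g z -> z != x -> z != y ->
  connect (move (@adj g K L) (npart z - D)) z x || connect (move (@adj g K L) (npart z - D)) z y.

Let G := (npart x - m)%N.
Let fs : finType := {s : config K L | feasible g s}.
Let xs : fs := Sub x fx.
Let ys : fs := Sub y fy.
Let N := ((K * L)%:R : R).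
Let C0 : R := #|fs|%:R ^+ 3 * N.

(** A configuration that first goes to [x] loses at most [D < G] particles, then crosses the saddle
    [G] below [x]; as it has no more particles than [x], the saddle is at most [G] below it. The
    target [y] may have more particles than [x], as on an odd grid when [y] is the even
    configuration. *)
Lemma depth_target z : feasible g z -> z != y -> connect (move (@adj g K L) (npart z - G)) z y.
Proof.
move=> fz zy; have [->|zx] := eqVneq z x.
  by apply: connect_move_le saddle; rewrite /G; lia.
have := x_ground fz zy => nz.
case/orP: (shallow fz zx zy) => h; last by apply: connect_move_le h; rewrite /G; lia.
apply: (connect_trans (y := x)); first by apply: connect_move_le h; rewrite /G; lia.
by apply: connect_move_le saddle; rewrite /G; lia.
Qed.

Lemma xs_neq_ys : xs != ys. Proof. by []. Qed.

Lemma N_ge1 : 1 <= N. Proof. by rewrite ler1n. Qed.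

Lemma card_fs_ge1 : 1 <= #|fs|%:R :> R.
Proof. by rewrite ler1n; apply/card_gt0P; exists xs. Qed.

Lemma C0_ge1 : 1 <= C0.
Proof. by rewrite /C0 mulr_ege1 ?exprn_ege1 ?card_fs_ge1 ?N_ge1. Qed.

Section FixedBeta.
Variable beta : R.
Hypothesis beta_gt0 : 0 < beta.
Let P := @Pf R g K L beta.

Let P0 := @Pf_ge0 R g K L beta beta_gt0.
Let P1 := @Pf_sum1 R g K L beta.

Lemma sum_surv_le n : \sum_(u < n) survival P (pred1 ys) u xs <= C0 * expR (beta * G%:R).
Proof.
rewrite -occupationE; last by rewrite /= xs_neq_ys.
have B0 : 0 <= #|fs|%:R ^+ 2 * N * expR (beta * G%:R).
  by rewrite !mulr_ge0 ?exprn_ge0 ?expR_ge0.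
have gB w : ~~ (pred1 ys) w -> green P (pred1 ys) n w w <= #|fs|%:R ^+ 2 * N * expR (beta * G%:R).
  move=> wy; apply: (@green_fstate R g K L beta beta_gt0 KL_gt0 _ n G w ys) => //=.
  by apply: depth_target => //; exact: valP.
apply: le_trans (occupation_le P0 P1 _ gB B0) _.
by rewrite /C0 exprS -!mulrA.
Qed.

Lemma sum_pair_le n z : z != ys ->
  \sum_(u < n) (if z == xs then 0 else survival P (pred2 xs ys) u z) <= C0 * expR (beta * D%:R).
Proof.
move=> zy; have [_|zx] := eqVneq z xs.
  by rewrite big1 // mulr_ge0 ?expR_ge0 // (le_trans ler01 C0_ge1).
rewrite -occupationE; last by rewrite /= negb_or zx.
have B0 : 0 <= #|fs|%:R ^+ 2 * N * expR (beta * D%:R).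
  by rewrite !mulr_ge0 ?exprn_ge0 ?expR_ge0.
have gB w : ~~ (pred2 xs ys) w -> green P (pred2 xs ys) n w w <= #|fs|%:R ^+ 2 * N * expR (beta * D%:R).
  rewrite /= negb_or => /andP[wx wy].
  case/orP: (shallow (valP w) wx wy) => h.
    by apply: (@green_fstate R g K L beta beta_gt0 KL_gt0 _ n D w xs) => //=; rewrite eqxx.
  by apply: (@green_fstate R g K L beta beta_gt0 KL_gt0 _ n D w ys) => //=; rewrite eqxx orbT.
apply: le_trans (occupation_le P0 P1 _ gB B0) _.
by rewrite /C0 exprS -!mulrA.
Qed.

(** The basin [W] is what [x] reaches with more than [m] particles. A transition out of [W] ends
    with at most [m] particles, otherwise its end would belong to [W]; hence its conductance is at
    most [expR (beta * m)]. *)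
Lemma escape_surv_le n :
  1 - survival P (pred1 ys) n xs <= n%:R * (C0 * expR (- (beta * G%:R))).
Proof.
pose W : pred fs := fun u => connect (move (@adj g K L) m.+1) x (val u).
have Wx : W xs by exact: connect0.
have npx : (m < npart x)%N by move: D_lt; lia.
have Wm u : W u -> (m < npart (val u))%N.
  rewrite /W => /connectP[p pp ->]; elim/last_ind: p pp => //= p s _.
  by rewrite rcons_path last_rcons => /andP[_ /and5P[]].
have := escape_le P0 P1 (@weight_gt0 R g K L beta)
  (@Pf_rev R g K L beta) n Wx (saddle_opt : ~~ W ys).
set c := \sum_(_ | _) _ => h.
have cle : c <= C0 * expR (beta * m%:R).
  apply: (@le_trans _ _ (\sum_(u : fs) \sum_(v : fs) expR (beta * m%:R))); last first.
    rewrite !sumr_const -!mulrnA -[leLHS]mulr_natl ler_wpM2r ?expR_ge0 //.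
    rewrite natrM /C0 -expr2 -[leLHS]mulr1 ler_pM ?exprn_ge0 // ?N_ge1 //.
    by rewrite exprS ler_peMl ?exprn_ge0 // card_fs_ge1.
  rewrite /c big_mkcond; apply: ler_sum => u _; case: ifP => [Wu|_]; last first.
    by rewrite sumr_ge0 // => v _; exact: expR_ge0.
  rewrite big_mkcond; apply: ler_sum => v _; case: ifP => [nWv|_]; last exact: expR_ge0.
  have uv : u != v by apply: contraNneq nWv => <-.
  rewrite weight_Pf //; case: ifP => [d1|_]; last exact: expR_ge0.
  rewrite -[leRHS]mul1r ler_pM ?invr_ge0 ?expR_ge0 ?invf_le1 ?ltr0n ?N_ge1 //.
  rewrite ler_expR ler_pM2l // ler_nat geq_min; apply/orP; right.
  rewrite leqNgt; apply: contra nWv => mv; rewrite /W.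
  apply: (connect_trans Wu); apply: connect1.
  by apply/and5P; split; [exact: valP | exact: valP | rewrite -ndiffE | exact: Wm | ].
have -> : n%:R * (C0 * expR (- (beta * G%:R))) = n%:R * (C0 * expR (beta * m%:R)) / weight beta xs.
  rewrite -[RHS]mulrA -[X in _ = _ * X]mulrA; congr (_ * (_ * _)).
  rewrite /weight -expRN -expRD; congr expR.
  by rewrite /G natrB 1?ltnW //=; ring.
rewrite ler_pdivlMr ?weight_gt0 // mulrC (le_trans h) // ler_wpM2l //.
Qed.

Lemma close_to_geometric (T0 : R) :
  (\sum_(0 <= u < n) survival P (pred1 ys) u xs @[n --> \oo] --> T0)%classic -> forall n,
  `|survival P (pred1 ys) n xs - (1 - T0^-1) ^+ n| <=
  10 * C0 ^+ 2 * expR (- (beta * ((G%:R - D%:R) / 2))) * (1 + n%:R / T0).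
Proof.
pose S n := \sum_(u < n) survival P (pred1 ys) u xs.
move=> cT0; have cT : (S n @[n --> \oo] --> T0)%classic.
  by rewrite (_ : S = fun n => \sum_(0 <= u < n) survival P (pred1 ys) u xs) //;
     apply/funext => n; rewrite big_mkord.
have S_nd : {homo S : a b / (a <= b)%N >-> a <= b}.
  apply/nondecreasing_seqP => n; rewrite /S big_ord_recr /= lerDl.
  exact: survival_ge0.
have leT n : S n <= T0.
  by rewrite -(cvg_lim _ cT) //; apply: nondecreasing_cvgn_le => //; exact: cvgP cT.
have T1 : 1 <= T0 by have := leT 1%N; rewrite /S big_ord1.
have Tpos : 0 < T0 by exact: lt_le_trans T1.
have C1 := C0_ge1; have Cpos : 0 < C0 by exact: lt_le_trans C1.
(* [h] is the geometric mean of the two time scales: both [exp (beta D) / h] and [h / exp (beta G)]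
   equal the error [r]. The constant [10 * C0 ^+ 2] dominates [4 * C0 ^+ 2], from [E / T0], and
   [6 * C0], from the other error terms. *)
pose h := expR (beta * ((G%:R + D%:R) / 2)); pose r := expR (- (beta * ((G%:R - D%:R) / 2))).
have h1 : 1 <= h.
  rewrite -expR0 ler_expR mulr_ge0 ?(ltW beta_gt0) // divr_ge0 // addr_ge0 //.
pose k := (Num.truncn h).+1.
have kh : h <= k%:R by rewrite ltW // truncnS_gt.
have kh2 : k%:R <= 2 * h.
  have : (Num.truncn h)%:R <= h by rewrite truncn_le; lra.
  by rewrite /k -natr1; lra.
have r0 : 0 < r by exact: expR_gt0.
have EG : expR (beta * D%:R) = h * r by rewrite /h /r -expRD; congr expR; field.
have Eg : expR (- (beta * G%:R)) = r / h.
  by rewrite /h /r -expRN -expRD; congr expR; field.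
have hpos : 0 < h by exact: expR_gt0.
have fd : 1 - survival P (pred1 ys) (k + k) xs <= 4 * C0 * r.
  apply: le_trans (escape_surv_le (k + k)) _.
  rewrite Eg natrD; have -> : 4 * C0 * r = (2 * h + 2 * h) * (C0 * (r / h)) by field; lra.
  by rewrite ler_wpM2r ?lerD // mulr_ge0 ?divr_ge0 ?ltW.
have Tge : (4 * C0)^-1 * expR (beta * G%:R) <= T0.
  have c0 : 0 < C0 * expR (- (beta * G%:R)) by rewrite mulr_gt0 ?expR_gt0.
  have [n] := sum_ge_of_escape c0 escape_surv_le.
  by rewrite big_mkord expRN mulrA invfM invrK => /le_trans; apply; exact: leT.
have r1 : r <= 1.
  rewrite -expR0 ler_expR oppr_le0 mulr_ge0 ?(ltW beta_gt0) // divr_ge0 //.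
  by rewrite subr_ge0 ler_nat ltnW.
apply: (exponential_approx P0 P1 (m := k) (E := C0 * expR (beta * D%:R))
  (d := 4 * C0 * r) xs_neq_ys) => //.
- by move=> n z zy; exact: sum_pair_le.
- rewrite ler_pdivrMr // EG -/r.
  have Gr : expR (beta * G%:R) = h / r by rewrite /h /r expRN invrK -expRD; congr expR; field.
  have hT : h <= 4 * C0 * r * T0.
    have <- : 4 * C0 * r * ((4 * C0)^-1 * (h / r)) = h by field; lra.
    by rewrite -Gr ler_wpM2l // !mulr_ge0 // ltW.
  apply: (@le_trans _ _ (C0 * h)).
    by rewrite ler_wpM2l ?(ltW Cpos) // ler_piMr // ltW.
  apply: (@le_trans _ _ (C0 * (4 * C0 * r * T0))); first by rewrite ler_wpM2l ?(ltW Cpos).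
  have : 0 <= C0 ^+ 2 * r * T0 by rewrite !mulr_ge0 ?exprn_ge0 // ltW.
  rewrite expr2; lra.
- rewrite EG; have : C0 * (h * r) / k%:R <= C0 * r.
    rewrite ler_pdivrMr ?ltr0n //; rewrite -[leRHS]mulrA ler_wpM2l ?(ltW Cpos) // mulrC.
    by rewrite ler_wpM2l // ltW.
  rewrite -/r; have : C0 <= C0 ^+ 2 by rewrite expr2 ler_peMl // ltW.
  move: r0; nra.
Qed.

End FixedBeta.

Theorem metastable_hitting : hitting_asymptotics g x y (G%:R : R).
Proof.
have C1 := C0_ge1; have Cpos : 0 < C0 by exact: lt_le_trans C1.
have CC : C0 <= 10 * C0 ^+ 2 by rewrite expr2; nra.
have GD : D%:R < G%:R :> R by rewrite ltr_nat.
have fE beta n : 0 < beta -> surv g beta y n x = survival (@Pf R g K L beta) (pred1 ys) n xs.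
  by move=> b0; exact: (survE beta ys xs n).
apply: (@hitting_asymptotics_of_survival _ _ _ _ _ _ _ _ _ (10 * C0 ^+ 2) ((G%:R - D%:R) / 2)).
- by move=> beta n b0; rewrite fE //; apply: survival_ge0; exact: Pf_ge0.
- move=> beta n b0; rewrite !fE //; apply: survival_leS; first exact: Pf_ge0.
  exact: Pf_sum1.
- exact: le_trans CC.
- by rewrite divr_gt0 // subr_gt0.
- by rewrite ltr0n (leq_ltn_trans _ D_lt).
- move=> beta n b0; rewrite (eq_bigr (fun u => survival (@Pf R g K L beta) (pred1 ys) u xs));
    last by move=> u _; rewrite fE.
  rewrite big_mkord; apply: le_trans (sum_surv_le b0 n) _.
  by rewrite ler_wpM2r ?expR_ge0.
- move=> beta n b0; rewrite fE //; apply: le_trans (escape_surv_le b0 n) _.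
  by rewrite ler_wpM2l // ler_wpM2r ?expR_ge0.
- move=> beta T0 b0 cT n; rewrite fE //; apply: close_to_geometric => //.
  by under eq_fun do under eq_bigr do rewrite -fE //.
Qed.

End Metastability.

(** * Isoperimetry *)

Section LowerBound.
Variables (T : finType) (e : rel T) (par : T -> bool).
Hypothesis epar : forall v w, e v w -> par v != par w.
Notation conf := {ffun T -> bool}.

Definition cellular (C : eqType) (c : T -> C) : Prop :=
  (forall v w, c v = c w -> v != w -> e v w) /\
  (forall v, exists2 w, ~~ par w & c w = c v).

Definition occupied (C : eqType) (c : T -> C) (s : conf) (A : pred T) : bool :=
  [forall z, A z ==> [exists v, (c v == c z) && s v]].

Definition pure (b : bool) (s : conf) (A : pred T) : Prop := forall v, A v -> s v = (par v == b).

(* A cell is a clique containing an even site, so it carries at most one particle, and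
   exactly one in the even configuration. *)
Lemma cells_bound (C : eqType) (c : T -> C) (I : finType) (z : I -> T) (s : conf) :
  cellular c -> independent e s -> injective (c \o z) ->
  (forall i v, c v = c (z i) -> ~~ s v) ->
  (npart s + #|I| <= npart (pconf par false))%N.
Proof.
move=> [clique even] /independentP is1 zinj empty.
have /fin_all_exists[ev evP] : forall v, exists w, ~~ par w /\ c w = c v.
  by move=> v; have [w w1 w2] := even v; exists w.
have evc v : c (ev v) = c v by case: (evP v).
pose A := ev @: [pred v | s v]; pose B := (ev \o z) @: I.
have cA : #|A| = npart s.
  apply: card_in_imset => v w sv sw evw; apply/eqP/negPn/negP => vw.
  by apply: (is1 v w) => //; apply: clique => //; rewrite -evc evw evc.
have cB : #|B| = #|I|.
  by apply: card_imset => i j /(congr1 c); rewrite /= !evc => ij; apply: zinj.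
have dAB : A :&: B = finset.set0.
  apply/setP => u; rewrite !inE; apply/negP => /andP[/imsetP[v sv uv] /imsetP[i _ ui]].
  by have := empty i v; rewrite -(evc v) -uv ui /= evc => /(_ erefl)/negP[].
rewrite -cA -cB -[X in (_ <= X)%N]addn0 -(cards0 T) -dAB -cardsUI leq_add2r.
apply/subset_leq_card/fintype.subsetP => u; rewrite !inE ffunE eqbF_neg.
by case/orP => /imsetP[v _ ->]; apply: (evP _).1.
Qed.

Lemma occupiedPn (C : eqType) (c : T -> C) s (A : pred T) : ~~ occupied c s A ->
  exists2 z, A z & forall v, c v = c z -> ~~ s v.
Proof.
move=> /forallPn[z]; rewrite negb_imply => /andP[Az /existsPn none].
by exists z => // v /eqP cv; have := none v; rewrite cv.
Qed.

(** One empty cell is chosen in each unit outside [full]; the separation hypothesis makes these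
    cells distinct. *)
Lemma units_bound (C : eqType) (c : T -> C) (I : finType) (U : I -> pred T) (s : conf)
  (full : pred I) : cellular c -> independent e s ->
  (forall i i' z z', U i z -> U i' z' -> c z = c z' -> i = i') ->
  (forall i, ~~ full i -> ~~ occupied c s (U i)) ->
  (npart s + (#|I| - #|full|) <= npart (pconf par false))%N.
Proof.
move=> cc is1 sep nf.
have /fin_all_exists[z zP] : forall i : {i | ~~ full i}, exists z, U (val i) z /\
    forall v, c v = c z -> ~~ s v.
  by move=> i; have [z Uz zn] := occupiedPn (nf _ (valP i)); exists z.
have := cells_bound (z := z) cc is1 _ (fun i => (zP i).2).
have -> : #|{: {i | ~~ full i}}| = (#|I| - #|full|)%N.
  rewrite card_sig -(cardC full) addKn; apply: eq_card => i; by rewrite !inE.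
apply => i j /=; case: (zP i) => Ui _; case: (zP j) => Uj _ cij.
exact/val_inj/(sep _ _ _ _ Ui Uj cij).
Qed.

Section Isoperimetry.
Variables (I J : finType) (U : I -> pred T) (W : J -> pred T).
Variables (C C' : eqType) (cH : T -> C) (cV : T -> C').
Variables (can_odd : pred J) (exc : T -> pred J) (k : nat) (i_0 : I).
Hypotheses (cellH : cellular cH) (cellV : cellular cV).
Hypothesis sepH : forall i i' z z', U i z -> U i' z' -> cH z = cH z' -> i = i'.
Hypothesis sepV : forall j j' z z', W j z -> W j' z' -> cV z = cV z' -> j = j'.
Hypothesis fullH : forall i s, independent e s -> occupied cH s (U i) ->
  pure false s (U i) \/ pure true s (U i).
Hypothesis fullV : forall j s, independent e s -> occupied cV s (W j) ->
  pure false s (W j) \/ (can_odd j /\ pure true s (W j)).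
Hypothesis meet : forall i j, exists v, U i v && W j v.
Hypothesis even_nb : forall i, exists v w, [/\ U i v, ~~ par v & e w v].
Hypothesis two_odd : forall i j w, can_odd j -> ~~ exc w j ->
  exists a v, [/\ W j a, a != w, U i v, ~~ par v & e a v].
Hypothesis exc_le : forall w, (#|exc w| <= k)%N.

(** The neighbours [w] range over the whole graph and not only over [U i]. The even sites of a
    purely even unit block all of them, so such a unit is free; and [two_odd] may then look for its
    odd site, distinct from the newly filled one, outside [U i]. *)
Let free i (s : conf) := [forall v, forall w, U i v ==> ~~ par v ==> e w v ==> ~~ s w].

Lemma freeP i (s : conf) : reflect (forall v w, U i v -> ~~ par v -> e w v -> ~~ s w) (free i s).
Proof.
apply: (iffP forallP) => [h v w Uv pv ewv|h v].
  by have /forallP/(_ w) := h v; rewrite Uv pv ewv.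
apply/forallP => w; apply/implyP => Uv; apply/implyP => pv; apply/implyP => ewv.
exact: h Uv pv ewv.
Qed.

Lemma connect_exit (m : nat) (Q : pred conf) s t : connect (move e m) s t -> Q s -> ~~ Q t ->
  exists s1 s2, [/\ move e m s1 s2, Q s1 & ~~ Q s2].
Proof.
move=> /connectP[p]; elim: p s => [|u p IH] s /=; first by move=> _ -> ->.
move=> /andP[su pu] lst Qs nQt; have [Qu|nQu] := boolP (Q u); first exact: IH u pu lst Qu nQt.
by exists s, u.
Qed.

(* On the way from the even to the odd configuration, consider the first time at which no unit
   of the first family is free of odd neighbours: an odd particle has just been added at [w]. If
   some unit of the first family is then odd, the units of the second family run from it to a unit
   which was still free, hence they are not pure. *)
Lemma isoperimetry m : connect (move e m) (pconf par false) (pconf par true) ->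
  (m + 1 + minn #|I| (#|J| - k) <= npart (pconf par false))%N.
Proof.
move=> con; pose Q : pred conf := fun s => [exists i, free i s].
have Q0 : Q (pconf par false).
  apply/existsP; exists i_0; apply/freeP => v w _ pv ewv; rewrite ffunE.
  by have := epar ewv; rewrite (negbTE pv); case: (par w).
have Q1 : ~~ Q (pconf par true).
  apply/existsPn => i; have [v [w [Uv pv ewv]]] := even_nb i; apply/freeP => /(_ v w Uv pv ewv).
  by rewrite ffunE; have := epar ewv; rewrite (negbTE pv); case: (par w).
have [s1 [s2 [/and5P[is1 is2 /diff1P[w s2E] m1 _] /existsP[i0 /freeP f1] nQ2]]] :=
  connect_exit (Q := Q) con Q0 Q1.
have s2_s1 v : s2 v -> v != w -> s1 v by rewrite s2E ffunE; case: eqVneq.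
have ns1w : ~~ s1 w.
  apply: contra nQ2 => s1w; apply/existsP; exists i0; apply/freeP => v a Uv pv eav.
  by rewrite s2E ffunE; case: eqVneq => [->|_]; [rewrite s1w | exact: f1 eav].
have np2 : npart s2 = (npart s1).+1 by rewrite s2E npart_flip (negbTE ns1w).
suff : (npart s2 + minn #|I| (#|J| - k) <= npart (pconf par false))%N by rewrite np2; lia.
have [/existsP[i1 occ1]|none] := boolP [exists i, occupied cH s2 (U i)]; last first.
  apply: leq_trans (_ : npart s2 + (#|I| - #|pred0 : pred I|) <= _)%N.
    by rewrite card0 subn0 leq_add2l geq_minl.
  by apply: (units_bound cellH is2 sepH) => i _; have /existsPn := none.
have odd1 : pure true s2 (U i1).
  case: (fullH is2 occ1) => // even1; have /existsPn/(_ i1)/freeP[] := nQ2.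
  move=> v a Uv pv eav; apply/negP => sa; apply: (independentP _ _ is2 a v eav sa).
  by rewrite even1 // eqbF_neg.
apply: leq_trans (_ : npart s2 + (#|J| - #|exc w|) <= _)%N.
  rewrite leq_add2l (leq_trans (geq_minr _ _)) // leq_sub2l //; exact: exc_le.
apply: (units_bound cellV is2 sepV) => j nexc; apply/negP => occj.
case: (fullV is2 occj) => [evenj|[cj oddj]].
  have [v /andP[Uv Wv]] := meet i1 j.
  by have := odd1 v Uv; rewrite (evenj v Wv); case: (par v).
have [a [v [Wa aw Uv pv eav]]] := two_odd i0 cj nexc.
have sa : s2 a by rewrite oddj //; have := epar eav; rewrite (negbTE pv); case: (par a).
by have := f1 v a Uv pv eav; rewrite s2_s1.
Qed.

End Isoperimetry.
End LowerBound.

(** * Grids *)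

Definition line_adj (cyclic : bool) (n i j : nat) : bool :=
  [|| i.+1 == j, j.+1 == i |
      cyclic && ((i == 0) && (j.+1 == n) || (j == 0) && (i.+1 == n))]%N.

(* The product of two lines, each a path or an even cycle. A cycle of length 2 is the path of
   length 2, so cycles have length at least 4. *)
Record is_grid (T : finType) (e : rel T) (par : T -> bool) (cx cy : bool) (L K : nat)
    (X Y : T -> nat) : Prop := IsGrid {
  X_lt : forall v, (X v < L)%N;
  Y_lt : forall v, (Y v < K)%N;
  XY_inj : forall v w, X v = X w -> Y v = Y w -> v = w;
  XY_surj : forall i j, (i < L)%N -> (j < K)%N -> exists2 v, X v = i & Y v = j;
  adjE : forall v w, e v w = (Y v == Y w) && line_adj cx L (X v) (X w)
                          || (X v == X w) && line_adj cy K (Y v) (Y w);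
  parE : forall v, par v = odd (X v + Y v);
  L_ge2 : (2 <= L)%N;
  K_ge2 : (2 <= K)%N;
  L_cyc : cx -> ~~ odd L /\ (4 <= L)%N;
  K_cyc : cy -> ~~ odd K /\ (4 <= K)%N }.

Lemma line_adj_sym c n i j : line_adj c n i j = line_adj c n j i.
Proof. by rewrite /line_adj; case: c; lia. Qed.

Lemma is_grid_swap T e par cx cy L K X Y :
  @is_grid T e par cx cy L K X Y -> @is_grid T e par cy cx K L Y X.
Proof.
case=> h1 h2 h3 h4 h5 h6 h7 h8 h9 h10; split=> //.
- by move=> v w yv xv; apply: h3.
- by move=> i j iK jL; have [v v1 v2] := h4 _ _ jL iK; exists v.
- by move=> v w; rewrite h5 orbC.
- by move=> v; rewrite h6 addnC.
Qed.

Section Grid.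
Variables (T : finType) (e : rel T) (par : T -> bool) (cx cy : bool) (L K : nat).
Variables (X Y : T -> nat).
Hypothesis G : is_grid e par cx cy L K X Y.
Notation conf := {ffun T -> bool}.

Lemma grid_sym : symmetric e.
Proof.
move=> v w; rewrite !(adjE G) [Y v == _]eq_sym [X v == _]eq_sym.
by rewrite line_adj_sym [line_adj cy _ _ _]line_adj_sym.
Qed.

Lemma line_adj_odd (c : bool) n i j : (c -> ~~ odd n) -> line_adj c n i j -> odd i != odd j.
Proof. by rewrite /line_adj; case: c => [/(_ isT)|_]; lia. Qed.

Lemma grid_par v w : e v w -> par v != par w.
Proof.
rewrite (adjE G) !(parE G) !oddD => /orP[] /andP[/eqP-> /line_adj_odd h].
  by have := h (fun c => (L_cyc G c).1); case: (odd (X v)); case: (odd (X w)); case: (odd _).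
by have := h (fun c => (K_cyc G c).1); case: (odd (Y v)); case: (odd (Y w)); case: (odd _).
Qed.

Lemma adj_X v w : Y v = Y w -> (X v).+1 = X w -> e v w.
Proof. by move=> yv xv; rewrite (adjE G) yv /line_adj xv !eqxx. Qed.

Lemma adj_Y v w : X v = X w -> (Y v).+1 = Y w -> e v w.
Proof. by move=> xv yv; rewrite (adjE G) xv /line_adj yv !eqxx orbT. Qed.

Lemma adj_wrap v w : cx -> Y v = Y w -> X v = 0%N -> (X w).+1 = L -> e v w.
Proof.
by move=> c yv xv xw; rewrite (adjE G) yv /line_adj xv xw c !eqxx /= !orbT.
Qed.

Lemma col_nb v : exists2 w, X w = X v & e v w.
Proof.
have [lt|ge] := ltnP (Y v).+1 K.
  have [w xw yw] := XY_surj G (X_lt G v) lt; exists w => //; exact: adj_Y.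
have := Y_lt G v; have := K_ge2 G => K2 yv.
have lt : ((Y v).-1 < K)%N by lia.
have [w xw yw] := XY_surj G (X_lt G v) lt; exists w => //; rewrite grid_sym.
by apply: adj_Y => //; lia.
Qed.

Lemma row_nb v : exists2 w, Y w = Y v & e v w.
Proof.
have [lt|ge] := ltnP (X v).+1 L.
  have [w xw yw] := XY_surj G lt (Y_lt G v); exists w => //; exact: adj_X.
have := X_lt G v; have := L_ge2 G => L2 xv.
have lt : ((X v).-1 < L)%N by lia.
have [w xw yw] := XY_surj G lt (Y_lt G v); exists w => //; rewrite grid_sym.
by apply: adj_X => //; lia.
Qed.

Lemma grid_nb v : exists w, e v w.
Proof. by have [w _ vw] := col_nb v; exists w. Qed.

(** An empty site shares its cell, a clique, with a particle of parity [b]; being adjacent to it, it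
    has the other parity. *)
Lemma pure_of_parity (C : eqType) (c : T -> C) (s : conf) (A : pred T) b :
  cellular e par c -> independent e s -> occupied c s A ->
  (forall z v, A z -> c v = c z -> A v) ->
  (forall v, A v -> s v -> par v = b) -> pure par b s A.
Proof.
move=> [clique _] /independentP is1 /forallP occ closed sb v Av.
have := occ v; rewrite Av => /existsP[q /andP[/eqP co so]].
have po : par q = b by apply: sb => //; exact: closed co.
have [->|ov] := eqVneq v q; first by rewrite so po eqxx.
have evo : e v q by apply: clique.
have -> : s v = false by apply/negP => sv; exact: (is1 v q).
by have := grid_par evo; rewrite po => /negbTE.
Qed.

(* Ladders of two consecutive rows, partitioned into rungs; when the number of rows is odd, the
   last row is a unit by itself, partitioned into horizontal dimers. *)
Section Ladders.

Definition last_row v := odd K && ((Y v).+1 == K).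
Definition ladder_cell v : nat * nat :=
  (if last_row v then (X v)./2 else X v, (Y v)./2).
Definition ladder (i : nat) : pred T := fun v => (Y v)./2 == i.

Lemma ladder_cellular : cellular e par ladder_cell.
Proof.
split=> [v w|v].
  rewrite /ladder_cell /last_row => -[cX cY] /eqP vw.
  have yv := Y_lt G v; have yw := Y_lt G w.
  have [eY|nY] := eqVneq (Y v) (Y w).
    move: cX; rewrite eY; case: ifP => _ eX; last by case: vw; apply: (XY_inj G).
    have nX : X v != X w by apply/eqP => eX'; case: vw; apply: (XY_inj G).
    have [h|h] : (X v).+1 = X w \/ (X w).+1 = X v by lia.
      exact: adj_X.
    by rewrite grid_sym; apply: adj_X.
  have eX : X v = X w by move: cX; do 2!case: ifP; lia.
  have [h|h] : (Y v).+1 = Y w \/ (Y w).+1 = Y v by lia.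
    exact: adj_Y.
  by rewrite grid_sym; apply: adj_Y.
have [pv|pv] := boolP (par v); last by exists v.
rewrite /ladder_cell; have := pv; rewrite (parE G) => oXY.
have xv := X_lt G v; have yv := Y_lt G v.
case: ifP => lv; move: (lv); rewrite /last_row => lv'.
  have lt : ((X v).-1 < L)%N by lia.
  have [w xw yw] := XY_surj G lt yv; exists w; first by rewrite (parE G); lia.
  by rewrite /last_row yw lv' xw; congr (_, _); lia.
pose y' := if odd (Y v) then (Y v).-1 else (Y v).+1.
have lt : (y' < K)%N by rewrite /y'; case: ifP; lia.
have [w xw yw] := XY_surj G xv lt; exists w.
  by rewrite (parE G) xw yw /y'; case: ifP; lia.
rewrite /last_row xw yw; congr (_, _); last by rewrite /y'; case: ifP; lia.
by rewrite ifF // /y'; case: ifP; lia.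
Qed.

(** On two rows, particles on consecutive rungs cannot share a row, so they alternate and have one
    parity. On a single row of odd length, a particle at odd abscissa forces the next dimer to hold
    its particle at the next odd abscissa, until the last dimer, which is one even site: only the
    even case remains. *)
Lemma ladder_full i s : (i.*2 < K)%N -> ((i.*2).+1 = K -> odd L) ->
  independent e s -> occupied ladder_cell s (ladder i) ->
  pure par false s (ladder i) \/ ((i.*2).+1 < K)%N /\ pure par true s (ladder i).
Proof.
move=> iK oL is1 occ; have ind := independentP _ _ is1.
have closed z v : ladder i z -> ladder_cell v = ladder_cell z -> ladder i v.
  by rewrite /ladder /ladder_cell => /eqP <- [_ ->].
have pureP b := pure_of_parity (b := b) ladder_cellular is1 occ closed.
have get x : (x < L)%N -> exists q, [/\ ladder i q, s q & ladder_cell q =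
    (if (i.*2).+1 == K then x./2 else x, i)].
  move=> xL; have [z xz yz] := XY_surj G xL iK.
  have lz : ladder i z by rewrite /ladder yz doubleK.
  have /forallP/(_ z) := occ; rewrite lz => /existsP[q /andP[/eqP co so]].
  exists q; split=> //; first exact: closed co.
  rewrite co /ladder_cell /last_row yz doubleK xz; congr (_, _).
  by case: eqP => [<-|_]; rewrite ?andbF //= odd_double.
have [ltK|/esym eK] : ((i.*2).+1 < K)%N \/ K = (i.*2).+1 by lia.
  have getx x : (x < L)%N -> exists q, [/\ ladder i q, s q & X q = x].
    move=> /get[q [lo so co]]; exists q; split=> //; move: co lo.
    rewrite (ltn_eqF ltK) /ladder_cell /last_row /ladder => -[+ _] /eqP yo.
    by case: ifP => // /andP[oK /eqP yK]; lia.
  have [q0 [lo0 so0 xo0]] := getx 0%N (ltn_trans (ltn0Sn 0) (L_ge2 G)).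
  have same x v : X v = x -> ladder i v -> s v -> par v = par q0.
    elim: x v => [|x IH] v xv lv sv.
      have yv := Y_lt G v; have yo := Y_lt G q0.
      have [->//|/eqP vo] := eqVneq v q0.
      have evo : e v q0.
        apply: ladder_cellular.1; last exact/eqP.
        rewrite /ladder_cell; move: lv lo0; rewrite /ladder => /eqP lv /eqP lo.
        by rewrite lv lo /last_row !ifF ?xv ?xo0 //; lia.
      by case: (ind _ _ evo sv so0).
    have xL : (x < L)%N by have := X_lt G v; lia.
    have [q [lo so xo]] := getx x xL; rewrite -(IH q xo lo so).
    have [yE|yN] := eqVneq (Y q) (Y v).
      by case: (ind q v _ so sv); apply: adj_X => //; lia.
    by move: lo lv; rewrite /ladder !(parE G) => /eqP lo /eqP lv; lia.
  have sb v : ladder i v -> s v -> par v = par q0 by move=> lv; exact: same.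
  case po: (par q0) in sb; last by left; exact: pureP.
  by right; split=> //; exact: pureP.
left; apply: pureP => v lv sv; move: (lv); rewrite /ladder => /eqP yv.
have yK : Y v = i.*2 by have := Y_lt G v; lia.
rewrite (parE G) yK oddD odd_double addbF; apply/negbTE/negP => oX.
have [n] := ubnP (L - X v); elim: n v lv sv {yv yK} oX => // n IH v lv sv oX le_n.
have xv := X_lt G v; have oL' := oL eK.
have xL : ((X v).+1 < L)%N by lia.
have [q [lo so]] := get _ xL; rewrite eK eqxx /ladder_cell => -[+ _].
have yo := Y_lt G q; move: (lo) (lv); rewrite /ladder => /eqP ho /eqP hv.
have yvK := Y_lt G v.
rewrite /last_row -{1}eK /= odd_double /=; case: eqP => [yo'|]; last by lia.
move=> xo; have [x1|x2] : X q = (X v).+1 \/ X q = (X v).+2 by lia.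
  by apply: (ind v q) => //; apply: adj_X => //; lia.
by apply: (IH q); rewrite ?x2 //=; lia.
Qed.

End Ladders.

(* A cycle, partitioned into dimers: an occupied second half of a dimer forces the next dimer to
   be in the same state, and this goes around. *)
Section Cycles.
Hypothesis cyc : cx.

Definition cycle_cell v : nat * nat := ((X v)./2, Y v).
Definition row (i : nat) : pred T := fun v => Y v == i.

Lemma cycle_cellular : cellular e par cycle_cell.
Proof.
have [eL _] := L_cyc G cyc.
split=> [v w|v].
  rewrite /cycle_cell => -[cX cY] /eqP vw.
  have nX : X v != X w by apply/eqP => eX'; case: vw; apply: (XY_inj G).
  have [h|h] : (X v).+1 = X w \/ (X w).+1 = X v by lia.
    exact: adj_X.
  by rewrite grid_sym; apply: adj_X.
have [pv|pv] := boolP (par v); last by exists v.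
have := pv; rewrite (parE G) => oXY.
have xv := X_lt G v; have yv := Y_lt G v.
pose x' := if odd (X v) then (X v).-1 else (X v).+1.
have lt : (x' < L)%N by rewrite /x'; case: ifP; lia.
have [w xw yw] := XY_surj G lt yv; exists w.
  by rewrite (parE G) xw yw /x'; case: ifP; lia.
by rewrite /cycle_cell xw yw; congr (_, _); rewrite /x'; case: ifP; lia.
Qed.

Lemma cycle_full i s : (i < K)%N -> independent e s -> occupied cycle_cell s (row i) ->
  pure par false s (row i) \/ pure par true s (row i).
Proof.
move=> iK is1 occ; have ind := independentP _ _ is1; have [eL L4] := L_cyc G cyc.
have closed z v : row i z -> cycle_cell v = cycle_cell z -> row i v.
  by rewrite /row /cycle_cell => /eqP <- [_ ->].
have pureP b := pure_of_parity (b := b) cycle_cellular is1 occ closed.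
have get x : (x < L)%N -> exists q, [/\ row i q, s q & (X q)./2 = x./2].
  move=> xL; have [z xz yz] := XY_surj G xL iK.
  have lz : row i z by rewrite /row yz.
  have /forallP/(_ z) := occ; rewrite lz => /existsP[q /andP[/eqP co so]].
  by exists q; split=> //; [exact: closed co | case: co => ->; rewrite xz].
have [/existsP[v0 /and3P[r0 s0 q0]]|none] := boolP [exists v, [&& row i v, s v & odd (X v)]].
  have run n : exists v, [/\ row i v, s v, odd (X v) & X v = (X v0 + n.*2) %% L]%N.
    elim: n => [|n [v [rv sv oX xv]]].
      by exists v0; split=> //; rewrite addn0 modn_small // (X_lt G).
    have xL := X_lt G v.
    have E : ((X v0 + (n.+1).*2) %% L = (X v + 2) %% L)%N.
      by rewrite xv modnDml; congr (_ %% _)%N; clear; lia.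
    have [/eqP xvL|xvL] := boolP ((X v).+1 == L).
      have [q [rq sq xq2]] := get 0%N (ltnW (ltnW (ltnW L4))).
      suff xq : X q = 1%N.
        exists q; split=> //; rewrite ?xq // E (_ : X v + 2 = L + 1)%N; last by clear -xvL; lia.
        by rewrite modnDl modn_small //; clear -L4; lia.
      have [x0|//] : X q = 0%N \/ X q = 1%N by clear -xq2; lia.
      by case: (ind q v _ sq sv); apply: adj_wrap => //; move: rq rv => /eqP -> /eqP.
    have xL' : ((X v).+1 < L)%N by clear -xvL xL; lia.
    have [q [rq sq xq]] := get _ xL'.
    have [x1|x2] : X q = (X v).+1 \/ X q = (X v + 2)%N by clear -xq oX; lia.
      by case: (ind v q _ sv sq); apply: adj_X => //; move: rq rv => /eqP -> /eqP.
    exists q; split=> //; first by clear -oX x2; lia.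
    by rewrite E modn_small //; have := X_lt G q; clear -x2; lia.
  have sb v : row i v -> s v -> par v = odd i.+1.
    move=> rv sv; move: (rv) => /eqP yv; rewrite (parE G) yv.
    suff : odd (X v) by lia.
    apply/negPn/negP => eX; have xv := X_lt G v; have x0 := X_lt G v0.
    (* The particle that the cycle forces at [X v + 1], next to [v]; adding [L] keeps the
       subtraction from truncating. *)
    have [u [ru su _ xu]] := run (((X v).+1 + L - X v0)./2).
    have xE : X u = (X v).+1.
      have h : (X v0 + (((X v).+1 + L - X v0)./2).*2 = (X v).+1 + L)%N.
        by clear -q0 eX eL x0; lia.
      by rewrite xu h modnDr modn_small //; clear -xv eX eL; lia.
    by apply: (ind v u) => //; apply: adj_X => //; move: ru => /eqP ->.
  by case: (odd i.+1) sb => sb; [right | left]; exact: pureP.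
have sb v : row i v -> s v -> par v = odd i.
  move=> rv sv; move: (rv) => /eqP yv; rewrite (parE G) yv.
  by have /existsPn/(_ v) := none; rewrite rv sv /=; lia.
by case: (odd i) sb => sb; [right | left]; exact: pureP.
Qed.

End Cycles.
End Grid.

(** * Depth of arbitrary configurations *)

Section LineDepth.
Variables (T : finType) (e : rel T) (par : T -> bool) (cx cy : bool) (L K : nat).
Variables (X Y : T -> nat).
Hypothesis G : is_grid e par cx cy L K X Y.
Notation conf := {ffun T -> bool}.

Let col0 : pred T := fun v => X v == 0%N.

Lemma col_rank w : ~~ col0 w ->
  exists u0, forall u, e w u -> u != u0 ->
  exists2 w', e u w' & par w' = par w /\ (X w' < X w)%N.
Proof.
rewrite /col0 => nw; have xw := X_lt G w.
have [u0 u0P] : exists u0, ((X w).+1 < L)%N -> X u0 = (X w).+1 /\ Y u0 = Y w.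
  have [lt|ge] := ltnP (X w).+1 L; last by exists w.
  by have [u0 x0 y0] := XY_surj G lt (Y_lt G w); exists u0.
exists u0 => u ewu uu0.
have goal w' : e u w' -> (X w' < X w)%N ->
    exists2 w', e u w' & par w' = par w /\ (X w' < X w)%N.
  move=> euw lt; exists w' => //; split=> //.
  have := grid_par G euw; have := grid_par G ewu.
  by case: (par u); case: (par w); case: (par w').
have xu := X_lt G u.
move: (ewu); rewrite (adjE G) => /orP[/andP[/eqP yE]|/andP[/eqP xE _]].
  have [w' xw' euw'] := col_nb G u.
  case/or3P => [/eqP xE|/eqP xE|/andP[_ /orP[]/andP[/eqP x1 /eqP x2]]].
  - case/eqP: uu0; have lt : ((X w).+1 < L)%N by rewrite xE.
    by have [h1 h2] := u0P lt; apply: (XY_inj G); rewrite ?h1 ?h2.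
  - by apply: (goal w') => //; rewrite xw' -xE.
  - by rewrite x1 in nw.
  - by apply: (goal w') => //; rewrite xw' x1 lt0n.
have lt : ((X u).-1 < L)%N by lia.
have [w' xw' yw'] := XY_surj G lt (Y_lt G u).
apply: (goal w'); last by rewrite xw' xE; lia.
by rewrite (grid_sym G); apply: (adj_X G) => //; lia.
Qed.

Lemma col_out w : col0 w ->
  (#|[pred u | e w u && ~~ col0 u]| <= if cx then 2 else 1)%N.
Proof.
rewrite /col0 => /eqP xw.
have L2 := L_ge2 G; have lt : (L.-1 < L)%N by lia.
have [a xa ya] := XY_surj G L2 (Y_lt G w); have [b xb yb] := XY_surj G lt (Y_lt G w).
apply: leq_trans (_ : size (a :: nseq cx b) <= _)%N; last by case: cx.
apply: leq_trans (card_size _); apply/subset_leq_card/fintype.subsetP => u; rewrite !inE.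
rewrite (adjE G) /line_adj xw => /andP[/orP[/andP[/eqP yE h]|/andP[/eqP xE _]] nu]; last first.
  by move: nu; rewrite -xE.
case/or3P: h => [/eqP xE|//|/andP[c /orP[]/andP[/eqP x1 /eqP x2]]].
- by rewrite (_ : u = a) ?eqxx //; apply: (XY_inj G); rewrite ?xa ?ya.
- rewrite c /= inE (_ : u = b) ?eqxx ?orbT //; apply: (XY_inj G); rewrite ?xb ?yb //.
  by rewrite -x2.
- by rewrite x1 in nu.
Qed.

(** The boolean [cx], read as a number, is [t - 1]: a site of column 0 has one outside neighbour
    when rows are paths, so refilling it loses nothing, and two when rows are cycles. *)
Lemma col_sweep b s : independent e s ->
  connect (move e (npart s - (#|[pred v | [&& par v != b, col0 v & s v]]| +
    cx * #|[pred v | [&& par v == b, col0 v & ~~ s v]]| + 1))) s (pconf par b).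
Proof.
move=> is1.
have := @sweep T e par (grid_sym G) (grid_par G) b col0 X (if cx then 2 else 1).
move=> /(_ (grid_nb G) _ _ _ s is1).
have -> : ((if cx then 2 else 1).-1 = cx)%N by case: cx.
apply.
- by case: cx.
- by move=> w pw nw; have [u0 h] := col_rank nw; exists u0; rewrite -pw.
- by move=> w _; exact: col_out.
Qed.

Lemma card_col0 : (#|col0| <= K)%N.
Proof.
rewrite -[leqRHS]card_ord; apply: (@leq_card_in _ _ (fun v => Ordinal (Y_lt G v))).
move=> u v /eqP xu /eqP xv [] yE.
by apply: (XY_inj G) => //; rewrite xu.
Qed.

(* Pair the sites below and above the odd particle [v0] separately. *)
Lemma card_col_mixed s v0 : independent e s -> col0 v0 -> s v0 -> par v0 ->
  (#|[pred v | col0 v && s v]| <= K./2)%N.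
Proof.
move=> /independentP ind; rewrite /col0 => /eqP x0 s0; rewrite (parE G) x0 add0n => o0.
pose phi v := if (Y v < Y v0)%N then (Y v)./2 else (Y v).-1./2.
have phi_lt v : (phi v < K./2)%N.
  by rewrite /phi; have := Y_lt G v; have := Y_lt G v0; case: ifP; move: o0; clear; lia.
rewrite -[K./2]card_ord; apply: (@leq_card_in _ _ (fun v => Ordinal (phi_lt v))).
move=> u v; rewrite !inE => /andP[/eqP xu su] /andP[/eqP xv sv] [].
have xuv : X u = X v by rewrite xu.
have nadj a b : s a -> s b -> X a = X b -> (Y a).+1 <> Y b.
  by move=> sa sb xab yab; apply: (ind a b) => //; exact: (adj_Y G).
have h1 := nadj u v su sv xuv; have h2 := nadj v u sv su (esym xuv).
have h3 := nadj u v0 su s0 (etrans xu (esym x0)).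
have h4 := nadj v v0 sv s0 (etrans xv (esym x0)).
have h5 := nadj v0 u s0 su (etrans x0 (esym xu)).
have h6 := nadj v0 v s0 sv (etrans x0 (esym xv)).
move=> E; apply: (XY_inj G) => //; move: E; rewrite /phi.
by clear -h1 h2 h3 h4 h5 h6 o0; do 2!case: ifP; lia.
Qed.

(** For cyclic rows the costs of the two colours add up to at most the length of the column, so one
    is at most half of it. For open rows only particles of the wrong colour cost: either there is no
    odd one, or the column has at most [K./2] particles and the rarer colour at most half of
    these. *)
Lemma col_depth s : independent e s -> exists b,
  connect (move e (npart s - ((if cx then K./2 else K./2./2) + 1))) s (pconf par b).
Proof.
move=> is1; pose Pb b := #|[pred v | [&& par v != b, col0 v & s v]]|.
pose M b := #|[pred v | [&& par v == b, col0 v & ~~ s v]]|.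
suff [b bP] : exists b, (Pb b + cx * M b <= if cx then K./2 else K./2./2)%N.
  by exists b; apply: connect_move_le (col_sweep b is1); rewrite -/(Pb b) -/(M b); lia.
have split2 (A : pred T) :
    (#|[pred v | A v && par v]| + #|[pred v | A v && ~~ par v]| = #|A|)%N.
  rewrite -(cardID par A); congr (_ + _)%N; apply: eq_card => v; rewrite !inE //.
  by rewrite andbC.
have PbT : Pb true = #|[pred v | (col0 v && s v) && ~~ par v]|.
  by apply: eq_card => v; rewrite !inE; case: (par v); rewrite ?andbF ?andbT.
have PbF : Pb false = #|[pred v | (col0 v && s v) && par v]|.
  by apply: eq_card => v; rewrite !inE; case: (par v); rewrite ?andbF ?andbT.
have MT : M true = #|[pred v | (col0 v && ~~ s v) && par v]|.
  by apply: eq_card => v; rewrite !inE; case: (par v); rewrite ?andbF ?andbT.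
have MF : M false = #|[pred v | (col0 v && ~~ s v) && ~~ par v]|.
  by apply: eq_card => v; rewrite !inE; case: (par v); rewrite ?andbF ?andbT.
have P2 : (Pb false + Pb true = #|[pred v | col0 v && s v]|)%N.
  by rewrite PbF PbT; exact: (split2 [pred v | col0 v && s v]).
have M2 : (M true + M false = #|[pred v | col0 v && ~~ s v]|)%N.
  by rewrite MT MF; exact: (split2 [pred v | col0 v && ~~ s v]).
have colE : (#|[pred v | col0 v && s v]| + #|[pred v | col0 v && ~~ s v]| = #|col0|)%N.
  rewrite -(cardID s col0); congr (_ + _)%N; apply: eq_card => v; rewrite !inE //.
  by rewrite andbC.
have cK := card_col0.
case: (cx).
  have [le|gt] := leqP (Pb true + 1 * M true) K./2; first by exists true.
  by exists false; lia.
have [/existsP[v0 /and3P[c0 s0 p0]]|none] := boolP [exists v, [&& col0 v, s v & par v]].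
  have mix := card_col_mixed is1 c0 s0 p0.
  have [le|gt] := leqP (Pb true) K./2./2; first by exists true; rewrite mul0n addn0.
  exists false; rewrite mul0n addn0; lia.
exists false; rewrite mul0n addn0 PbF eq_card0 // => v; rewrite !inE -andbA.
by have /existsPn/(_ v)/negbTE := none.
Qed.

End LineDepth.

(** With [K] odd and [L] even the last row is left out: all its dimers can be occupied while the row
    changes from even to odd particles, so it need not be pure. *)
Definition n_ladder (L K : nat) : nat := if odd K && odd L then uphalf K else K./2.

Lemma ladder_lt L K (i : 'I_(n_ladder L K)) : (i.*2 < K)%N.
Proof.
by move: (nat_of_ord i) (ltn_ord i) => k; rewrite /n_ladder; case: ifP; lia.
Qed.

Lemma ladder_last L K (i : 'I_(n_ladder L K)) : (i.*2).+1 = K -> odd L.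
Proof.
by move: (nat_of_ord i) (ltn_ord i) => k; rewrite /n_ladder; case: ifP; lia.
Qed.

Section Barrier.
Variables (T : finType) (e : rel T) (par : T -> bool) (cx cy : bool) (L K : nat).
Variables (X Y : T -> nat).
Hypothesis G : is_grid e par cx cy L K X Y.
Notation conf := {ffun T -> bool}.

Lemma grid_depth s : independent e s -> exists b,
  connect (move e (npart s - (minn (if cx then K./2 else K./2./2)
                                   (if cy then L./2 else L./2./2) + 1))) s (pconf par b).
Proof.
move=> is1; case: leqP => _; first exact: col_depth G _ is1.
exact: col_depth (is_grid_swap G) _ is1.
Qed.

Lemma npart_le s : independent e s -> (npart s <= npart (pconf par false))%N.
Proof.
move=> is1.
have noI (i : 'I_0) : False by case: i.
have := cells_bound (z := fun i => False_rect T (noI i)) (ladder_cellular G) is1.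
by rewrite card_ord addn0; apply => i; case: (noI i).
Qed.

Lemma even_site (C : eqType) (c : T -> C) (A : pred T) z : cellular e par c ->
  (forall z v, A z -> c v = c z -> A v) -> A z ->
  exists v w, [/\ A v, ~~ par v & e w v].
Proof.
move=> [_ even] closed Az; have [v pv cv] := even z; have [w evw] := grid_nb G v.
by exists v, w; rewrite (grid_sym G) evw; split=> //; exact: closed Az cv.
Qed.

Lemma ladder_sep n (i i' : 'I_n) z z' : ladder Y i z -> ladder Y i' z' ->
  ladder_cell K X Y z = ladder_cell K X Y z' -> i = i'.
Proof. by rewrite /ladder => /eqP iz /eqP iz' [_ yE]; apply: ord_inj; rewrite -iz -iz' yE. Qed.

Lemma ladder_even (i : 'I_(n_ladder L K)) : exists v w, [/\ ladder Y i v, ~~ par v & e w v].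
Proof.
have [z xz yz] := XY_surj G (ltnW (L_ge2 G)) (ladder_lt i).
apply: (even_site (z := z) (ladder_cellular G)); last by rewrite /ladder yz doubleK.
by move=> u v; rewrite /ladder => /eqP <- [_ ->].
Qed.

Lemma sym_adj_X v w : Y v = Y w -> (X v).+1 = X w \/ (X w).+1 = X v -> e v w.
Proof. by move=> yE [h|h]; [|rewrite (grid_sym G)]; apply: (adj_X G). Qed.

Lemma sym_adj_Y v w : X v = X w -> (Y v).+1 = Y w \/ (Y w).+1 = Y v -> e v w.
Proof. by move=> xE [h|h]; [|rewrite (grid_sym G)]; apply: (adj_Y G). Qed.

Lemma pick_other (a b w : T) (Q : T -> Prop) : a != b -> Q a -> Q b -> exists2 q, q != w & Q q.
Proof.
move=> ab Qa Qb; have [aw|] := eqVneq a w; last by exists a.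
by exists b => //; rewrite -aw eq_sym.
Qed.

End Barrier.

(** * Barrier heights for the three boundary conditions *)

Section Barriers.
Variables (T : finType) (e : rel T) (par : T -> bool) (cx cy : bool) (L K : nat).
Variables (X Y : T -> nat).
Hypothesis G : is_grid e par cx cy L K X Y.
Variable m : nat.
Hypothesis con : connect (move e m) (pconf par false) (pconf par true).

Let G' := is_grid_swap G.

Lemma n_ladder_gt0 : (0 < n_ladder L K)%N.
Proof. by have := K_ge2 G; rewrite /n_ladder; case: ifP; lia. Qed.

(** Units are pairs of rows against pairs of columns. The even site [(2j, 2i)] has two neighbours in
    the pair of columns [j], one beside it and one above or below, and at most one of them is [w]; a
    single last column is never purely odd when fully occupied. *)
Lemma barrier_ladders :
  (m + 1 + minn (n_ladder L K) (n_ladder K L) <= npart (pconf par false))%N.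
Proof.
have := isoperimetry (grid_par G) (I := 'I_(n_ladder L K)) (J := 'I_(n_ladder K L))
  (U := fun i => ladder Y i) (W := fun j => ladder X j)
  (cH := ladder_cell K X Y) (cV := ladder_cell L Y X)
  (can_odd := fun j => ((j.*2).+1 < L)%N) (exc := fun _ => pred0) (k := 0)
  (Ordinal n_ladder_gt0) (ladder_cellular G) (ladder_cellular G').
rewrite !card_ord subn0; apply=> //.
- exact: ladder_sep.
- exact: ladder_sep.
- move=> i s is1 occ; case: (ladder_full G (ladder_lt i) (@ladder_last _ _ i) is1 occ).
    by left.
  by case; right.
- move=> j s is1 occ; exact: (ladder_full G' (ladder_lt j) (@ladder_last _ _ j) is1 occ).
- move=> i j; have [v xv yv] := XY_surj G (ladder_lt j) (ladder_lt i).
  by exists v; rewrite /ladder xv yv !doubleK !eqxx.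
- exact: (ladder_even G).
- move=> i j w jL _; have iK := ladder_lt i; have jL' := ladder_lt j.
  have [v xv yv] := XY_surj G jL' iK.
  have [a xa ya] := XY_surj G jL iK.
  pose y' := if ((i.*2).+1 < K)%N then (i.*2).+1 else (i.*2).-1.
  have y'K : (y' < K)%N by rewrite /y'; case: ifP; lia.
  have y'E : y'.+1 = i.*2 \/ (i.*2).+1 = y'.
    by rewrite /y'; case: ifP => h; [right | left; have := K_ge2 G; lia].
  have [b xb yb] := XY_surj G jL' y'K.
  have [q qw [Wq qv]] : exists2 q, q != w & ladder X j q /\ e q v.
    apply: (@pick_other _ a b).
    - by apply: contraTneq isT => ab; move: xa; rewrite ab xb; lia.
    - split; first by rewrite /ladder xa; lia.
      by apply: (sym_adj_X G); rewrite ?ya ?yv //; right; rewrite xa xv.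
    - split; first by rewrite /ladder xb doubleK.
      by apply: (sym_adj_Y G); rewrite ?xb ?xv ?yb ?yv.
  exists q, v; split=> //; first by rewrite /ladder yv doubleK.
  by rewrite (parE G) xv yv oddD !odd_double.
- by move=> w; rewrite card0.
Qed.

(* If the columns are cycles, their pure configurations are seen without pairing them. *)
Lemma barrier_cyl : cy -> (m + 1 + minn K./2 L <= npart (pconf par false))%N.
Proof.
move=> c; have [eK K4] := K_cyc G c.
rewrite (_ : K./2 = n_ladder L K); last by rewrite /n_ladder (negbTE eK).
have := isoperimetry (grid_par G) (I := 'I_(n_ladder L K)) (J := 'I_L)
  (U := fun i => ladder Y i) (W := fun j => row X j)
  (cH := ladder_cell K X Y) (cV := cycle_cell Y X)
  (can_odd := predT) (exc := fun _ => pred0) (k := 0)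
  (Ordinal n_ladder_gt0) (ladder_cellular G) (cycle_cellular G' c).
rewrite !card_ord subn0; apply=> //.
- exact: ladder_sep.
- by rewrite /row => j j' z z' /eqP zj /eqP zj' [_ xE]; apply: ord_inj; rewrite -zj -zj' xE.
- move=> i s is1 occ; case: (ladder_full G (ladder_lt i) (@ladder_last _ _ i) is1 occ).
    by left.
  by case; right.
- move=> j s is1 occ; case: (cycle_full G' c (ltn_ord j) is1 occ); first by left.
  by right.
- move=> i j; have [v xv yv] := XY_surj G (ltn_ord j) (ladder_lt i).
  by exists v; rewrite /ladder /row xv yv doubleK !eqxx.
- exact: (ladder_even G).
- move=> i j w _ _; have iK := ladder_lt i; have jL := ltn_ord j.
  have iK1 : ((i.*2).+1 < K)%N by clear -iK eK; lia.
  (* [v] is the even site of column [j] in ladder [i]. Its two neighbours along the cyclic column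
     are [a], inside the ladder, and [b], beyond it and possibly across the wrap-around edge. *)
  pose y0 := if odd j then (i.*2).+1 else i.*2.
  pose ya := if odd j then i.*2 else (i.*2).+1.
  have ya0 : ya.+1 = y0 \/ y0.+1 = ya by rewrite /ya /y0; case: ifP; [left | right].
  have y0K : (y0 < K)%N by rewrite /y0; case: ifP.
  have yaK : (ya < K)%N by rewrite /ya; case: ifP.
  have [v xv yv] := XY_surj G jL y0K.
  have [a xa yaE] := XY_surj G jL yaK.
  have [b [xb ba ebv]] : exists b, [/\ X b = j, a != b & e b v].
    case oj: (odd j) (erefl y0) (erefl ya); rewrite {1}/y0 {1}/ya oj => y0E yaE'.
      have [lt|ge] := ltnP (i.*2).+2 K.
        have [b xb yb] := XY_surj G jL lt; exists b; split=> //.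
          by apply: contraTneq isT => ab; move: yaE; rewrite ab yb -yaE'; clear; lia.
        by apply: (sym_adj_Y G); rewrite ?xb ?yb ?yv -?y0E //; right.
      have [b xb yb] := XY_surj G jL (ltnW (ltnW (ltnW K4))); exists b; split=> //.
        by apply: contraTneq isT => ab; move: yaE; rewrite ab yb -yaE'; clear -ge K4; lia.
      apply: (adj_wrap G' c); rewrite ?xb ?yb ?yv -?y0E //; clear -ge iK1; lia.
    case i0: (nat_of_ord i) => [|k].
      have lt : (K.-1 < K)%N by clear -K4; lia.
      have [b xb yb] := XY_surj G jL lt; exists b; split=> //.
        by apply: contraTneq isT => ab; move: yaE; rewrite ab yb -yaE' i0; clear -K4; lia.
      rewrite (grid_sym G); apply: (adj_wrap G' c); rewrite ?xb ?yb ?yv -?y0E ?i0 //.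
      by clear -K4; lia.
    have lt : ((k.*2).+1 < K)%N by clear -i0 iK; lia.
    have [b xb yb] := XY_surj G jL lt; exists b; split=> //.
      by apply: contraTneq isT => ab; move: yaE; rewrite ab yb -yaE' i0; clear; lia.
    by apply: (sym_adj_Y G); rewrite ?xb ?yb ?yv -?y0E ?i0 //; left.
  have [q qw [Wq qv]] : exists2 q, q != w & row X j q /\ e q v.
    apply: (@pick_other _ a b) => //; split; rewrite ?/row ?xa ?xb //.
    by apply: (sym_adj_Y G); rewrite ?xa ?xv ?yaE ?yv.
  exists q, v; split=> //; first by rewrite /ladder yv /y0; case: ifP; clear; lia.
  by rewrite (parE G) xv yv /y0; case: ifP; clear; lia.
- by move=> w; rewrite card0.
Qed.

(** Each row and each column is a unit. In the column of [w], the crossing with the free row may be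
    [w] itself, the only site of that column next to an even site of the row; this column is the
    exception, whence [L.-1]. *)
Lemma barrier_tor : cx -> cy -> (m + 1 + minn K L.-1 <= npart (pconf par false))%N.
Proof.
move=> c1 c2; have [eK K4] := K_cyc G c2; have [eL L4] := L_cyc G c1.
have := isoperimetry (grid_par G) (I := 'I_K) (J := 'I_L)
  (U := fun i => row Y i) (W := fun j => row X j)
  (cH := cycle_cell X Y) (cV := cycle_cell Y X)
  (can_odd := predT) (exc := fun w j => j == X w :> nat) (k := 1)
  (Ordinal (ltnW (K_ge2 G))) (cycle_cellular G c1) (cycle_cellular G' c2).
rewrite !card_ord subn1; apply=> //.
- by rewrite /row => j j' z z' /eqP zj /eqP zj' [_ xE]; apply: ord_inj; rewrite -zj -zj' xE.
- by rewrite /row => j j' z z' /eqP zj /eqP zj' [_ xE]; apply: ord_inj; rewrite -zj -zj' xE.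
- by move=> i s is1 occ; exact: (cycle_full G c1 (ltn_ord i) is1 occ).
- move=> j s is1 occ; case: (cycle_full G' c2 (ltn_ord j) is1 occ); first by left.
  by right.
- move=> i j; have [v xv yv] := XY_surj G (ltn_ord j) (ltn_ord i).
  by exists v; rewrite /row xv yv !eqxx.
- move=> i; have [z xz yz] := XY_surj G (ltnW (L_ge2 G)) (ltn_ord i).
  apply: (even_site (z := z) G (cycle_cellular G c1)); last by rewrite /row yz.
  by move=> u v; rewrite /row => /eqP <- [_ ->].
- move=> i j w _ nj; have [q xq yq] := XY_surj G (ltn_ord j) (ltn_ord i).
  have neq u : X u = j -> u != w by move=> xu; apply: contraNneq nj => <-; rewrite xu.
  have [pq|pq] := boolP (par q).
    have [v yv eqv] := row_nb G q; exists q, v; split; rewrite ?/row ?xq ?yv ?yq //.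
      by apply: neq.
    by have := grid_par G eqv; rewrite pq; case: (par v).
  have [a xa eqa] := col_nb G q; exists a, q; split; rewrite ?/row ?xa ?xq ?yq //.
    by apply: neq; rewrite xa.
  by rewrite (grid_sym G).
- move=> w; rewrite -(card1 (Ordinal (X_lt G w))); apply/subset_leq_card/fintype.subsetP => j.
  by move=> jw; rewrite inE; apply/eqP/ord_inj; apply/eqP; exact: jw.
Qed.

End Barriers.

(** * Grids with an odd number of sites *)

Section OddGrid.
Variables (T : finType) (e : rel T) (par : T -> bool) (cx cy : bool) (L K : nat).
Variables (X Y : T -> nat).
Hypothesis G : is_grid e par cx cy L K X Y.
Hypotheses (oK : odd K) (oL : odd L).
Notation conf := {ffun T -> bool}.

Lemma all_occupied (C : eqType) (c : T -> C) (s : conf) (A : pred T) :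
  cellular e par c -> independent e s -> (npart (pconf par false) <= npart s)%N ->
  occupied c s A.
Proof.
move=> cc is1 le; apply/negPn/negP => /occupiedPn[z _ empty].
have := cells_bound (z := fun _ : 'I_1 => z) cc is1 _ (fun _ => empty).
rewrite card_ord addn1 ltnNge le => h; have /h// : injective (c \o (fun _ : 'I_1 => z)).
by move=> i j _; rewrite (ord1 i) (ord1 j).
Qed.

(** With as many particles as the even configuration, no cell of either family is empty, so all
    ladders are pure. The single last column can only be even, and it meets every horizontal
    ladder. *)
Lemma even_unique_max s : independent e s -> s != pconf par false ->
  (npart s < npart (pconf par false))%N.
Proof.
move=> is1; apply: contraNltn => le; apply/eqP/ffunP => v; rewrite ffunE.
have G' := is_grid_swap G.
have L2 := L_ge2 G; have yK := Y_lt G v.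
have occ i := all_occupied (ladder Y i) (ladder_cellular G) is1 le.
have occ' j := all_occupied (ladder X j) (ladder_cellular G') is1 le.
have jL : ((L./2).*2 < L)%N by clear -oL; lia.
have [lastP|[]] := ladder_full G' jL (fun _ => oK) is1 (occ' _); last by clear -oL; lia.
have iK : (((Y v)./2).*2 < K)%N by clear -yK; lia.
have [evP|[_ odP]] := ladder_full G iK (fun _ => oL) is1 (occ _).
  by apply: evP; rewrite /ladder.
have LL : (L.-1 < L)%N by clear -L2; lia.
have [u xu yu] := XY_surj G LL iK.
have := odP u; have := lastP u; rewrite /ladder xu yu doubleK eqxx.
have -> : (L.-1)./2 == L./2 by clear -oL; lia.
by move=> /(_ isT) -> /(_ isT); case: (par u).
Qed.

(** The far corner is a cell by itself; every other even site shares its cell with an odd one, and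
    cells being cliques, this matching is injective. *)
Lemma npart_odd_even : (npart (pconf par true)).+1 = npart (pconf par false).
Proof.
have K2 := K_ge2 G; have L2 := L_ge2 G.
have LL : (L.-1 < L)%N by clear -L2; lia.
have KK : (K.-1 < K)%N by clear -K2; lia.
have [corner xc yc] := XY_surj G LL KK.
have pc : par corner = false by rewrite (parE G) xc yc; clear -oK oL; lia.
apply/eqP; rewrite eqn_leq; apply/andP; split.
  apply: even_unique_max; first exact: independent_pconf (grid_par G) _.
  by apply/eqP => /ffunP/(_ corner); rewrite !ffunE pc.
rewrite {1}/npart (cardD1 corner) inE ffunE pc /= add1n ltnS.
have partner v : ~~ par v -> v != corner ->
    exists w, par w /\ ladder_cell K X Y w = ladder_cell K X Y v.
  move=> pv vc; have xv := X_lt G v; have yv := Y_lt G v.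
  move: pv; rewrite (parE G) => pv.
  rewrite /ladder_cell; have [lv|nl] := boolP (last_row K Y v).
    move: lv; rewrite /last_row => /andP[_ /eqP yE].
    have nX : X v <> L.-1.
      move=> xE; case/eqP: vc; apply: (XY_inj G); rewrite ?xE ?xc // yc; clear -yE; lia.
    have lt : ((X v).+1 < L)%N by clear -nX xv; lia.
    have [w xw yw] := XY_surj G lt yv; exists w; rewrite (parE G) /last_row xw yw yE oK eqxx /=.
    split; first by clear -pv; lia.
    by congr (_, _); clear -pv yE oK; lia.
  pose y' := if odd (Y v) then (Y v).-1 else (Y v).+1.
  have nyK : (Y v).+1 <> K.
    by move=> yE; move: nl; rewrite /last_row yE oK eqxx.
  have lt : (y' < K)%N by rewrite /y'; case: ifP => _; clear -nyK yv; lia.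
  have [w xw yw] := XY_surj G xv lt; exists w; rewrite (parE G) /last_row xw yw; split.
    by rewrite /y'; case: ifP; clear -pv; lia.
  rewrite ifF; last by rewrite /y'; case: ifP; clear -oK nyK yv; lia.
  by congr (_, _); rewrite /y'; case: ifP; clear; lia.
pose phi v := odflt v [pick w | par w && (ladder_cell K X Y w == ladder_cell K X Y v)].
have phiP v : ~~ par v -> v != corner ->
    par (phi v) /\ ladder_cell K X Y (phi v) = ladder_cell K X Y v.
  move=> pv vc; rewrite /phi; case: pickP => [w /andP[pw /eqP cw] //|none].
  by have [w [pw cw]] := partner v pv vc; have := none w; rewrite pw cw eqxx.
rewrite -(card_in_imset (f := phi)).
  apply/subset_leq_card/fintype.subsetP => w /imsetP[v]; rewrite !inE ffunE => /andP[vc pv] ->.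
  have pv' : ~~ par v by rewrite -eqbF_neg.
  by rewrite ffunE; have [-> _] := phiP v pv' vc.
move=> u v; rewrite !inE !ffunE !eqbF_neg => /andP[uc pu] /andP[vc pv] E.
have [_ cu] := phiP u pu uc; have [_ cv] := phiP v pv vc.
apply/eqP/negPn/negP => uv.
have euv : e u v by apply: (ladder_cellular G).1 => //; rewrite -cu -cv E.
by have := grid_par G euv; rewrite (negbTE pu) (negbTE pv).
Qed.

End OddGrid.

(** * Application to the three grids *)

Section Assembly.
Variables (g : grid_kind) (K L : nat).
Hypothesis ok : grid_ok g K L.
Notation e := (@adj g K L).
Let X (v : site K L) : nat := v.1.
Let Y (v : site K L) : nat := v.2.
Let par (v : site K L) : bool := odd (v.1 + v.2).
Let cx := if g is Tor then (4 <= L)%N else false.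
Let cy := if g is Open then false else (4 <= K)%N.

Lemma distn_sum1 (a b c d : nat) : (distn a c + distn b d == 1)%N =
  (b == d) && line_adj false 0 a c || (a == c) && line_adj false 0 b d.
Proof. by rewrite /distn /line_adj; lia. Qed.

(** An even [n] below 4 is 2, where the wrap-around edge coincides with the open one. *)
Lemma line_adj_wrap n (i j : nat) : ~~ odd n -> (2 <= n)%N -> (i < n)%N -> (j < n)%N ->
  line_adj (4 <= n)%N n i j = line_adj false 0 i j ||
    ((i == 0) && (j == n.-1) || (i == n.-1) && (j == 0))%N.
Proof. by rewrite /line_adj; lia. Qed.

Lemma adj_is_grid : is_grid e par cx cy L K X Y.
Proof.
have [K2 [L2 par_ok]] := ok.
split=> //.
- by move=> v; exact: ltn_ord.
- by move=> v; exact: ltn_ord.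
- by move=> [a b] [c d]; rewrite /X /Y /= => /ord_inj -> /ord_inj ->.
- by move=> i j iL jK; exists (Ordinal iL, Ordinal jK).
- move=> [a b] [c d]; rewrite /adj /X /Y /cx /cy distn_sum1 /=.
  have := ltn_ord a; have := ltn_ord b; have := ltn_ord c; have := ltn_ord d.
  move: (nat_of_ord a) (nat_of_ord b) (nat_of_ord c) (nat_of_ord d) => {}a {}b {}c {}d dK cL bK aL.
  case: g par_ok => [_|eK|[eK eL]].
  + by rewrite /line_adj.
  + rewrite (line_adj_wrap eK K2 bK dK) -orbA -andb_orr.
    by congr (_ || _); congr (_ && _).
  + rewrite (line_adj_wrap eK K2 bK dK) (line_adj_wrap eL L2 aL cL).
    by rewrite [X in _ || X]orbC orbACA -!andb_orr.
- by rewrite /cx; case: g par_ok => // -[].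
- by rewrite /cy; case: g par_ok => // -[].
Qed.

Lemma econfE : econf K L = pconf par false.
Proof. by apply/ffunP => v; rewrite !ffunE eqbF_neg. Qed.

Lemma oconfE : oconf K L = pconf par true.
Proof. by apply/ffunP => v; rewrite !ffunE eqb_id. Qed.

Lemma parity_confs_connected : exists m, connect (move e m) (pconf par false) (pconf par true).
Proof.
have G := adj_is_grid.
by exists 0%N; apply: connect_move_le (col_sweep G true (independent_pconf (grid_par G) false)).
Qed.

Let D := (minn (if cx then K./2 else K./2./2) (if cy then L./2 else L./2./2) + 1)%N.

(** This is [D < Gam]; the extra unit on an odd grid gives [D < Gam - 1], for the transition from
    odd to even. *)
Lemma barrier m : connect (move e m) (pconf par false) (pconf par true) ->
  (m + D + 1 + (odd K && odd L) <= npart (pconf par false))%N.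
Proof.
move=> con; have G := adj_is_grid; have [K2 [L2 _]] := ok.
have bl := barrier_ladders G con.
case c1: cx; case c2: cy.
- have h := barrier_tor G con c1 c2; have [eK K4] := K_cyc G c2; have [eL L4] := L_cyc G c1.
  move: h; rewrite /D c1 c2 (negbTE eK); clear -K4 L4; lia.
(* A torus with [K = 2], which is a cylinder in the other direction. *)
- have h := barrier_cyl (is_grid_swap G) con c1; have [eL L4] := L_cyc G c1.
  move: h; rewrite /D c1 c2 (negbTE eL) andbF; clear -K2 L4 eL; lia.
- have h := barrier_cyl G con c2; have [eK K4] := K_cyc G c2.
  move: h; rewrite /D c1 c2 (negbTE eK); clear -L2 K4 eK; lia.
- move: bl; rewrite /D c1 c2 /n_ladder [odd L && _]andbC.
  have [/andP[oK oL]|_] := boolP (odd K && odd L); last by clear -K2 L2; lia.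
  by clear -K2 L2 oK oL; lia.
Qed.

Theorem hard_core_hitting (R : realType) : exists Gam : R, 0 < Gam /\
    hitting_asymptotics g (econf K L) (oconf K L) Gam /\
    (g = Open -> odd (K * L) ->
       hitting_asymptotics g (oconf K L) (econf K L) (Gam - 1)).
Proof.
have G := adj_is_grid; have [K2 [L2 _]] := ok.
have KL0 : (0 < K * L)%N by rewrite muln_gt0 (ltnW K2) (ltnW L2).
have ub m : connect (move e m) (pconf par false) (pconf par true) ->
    (m <= npart (pconf par false))%N by move/barrier; clear; lia.
case: (ex_maxnP parity_confs_connected ub) => m con mmax.
have nocon : ~~ connect (move e m.+1) (pconf par false) (pconf par true).
  by apply/negP => /mmax; rewrite ltnn.
have bar := barrier con.
have ie := independent_pconf (grid_par G) false; have io := independent_pconf (grid_par G) true.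
have [v0 _] := XY_surj G (ltnW L2) (ltnW K2).
have eo : pconf par false != pconf par true.
  by apply/eqP => /ffunP/(_ v0); rewrite !ffunE; case: (par v0).
have shallow z : independent e z -> z != pconf par false -> z != pconf par true ->
    connect (move e (npart z - D)) z (pconf par false) ||
    connect (move e (npart z - D)) z (pconf par true).
  by move=> iz _ _; have [[] ->] := grid_depth G iz; rewrite ?orbT.
exists (npart (pconf par false) - m)%:R; rewrite econfE oconfE; split; last split.
- by rewrite ltr0n; clear -bar; lia.
- apply: (metastable_hitting R ie io eo KL0 con nocon (D := D)) => //.
    by clear -bar; lia.
  by move=> z iz _; exact: npart_le G _ iz.
- move=> _; rewrite oddM => odd2; have [oK oL] := andP odd2.
  have noe := npart_odd_even G oK oL.
  (* The saddle level [m] is the same in both directions; the odd configuration starts one particle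
     lower. *)
  have -> : (npart (pconf par false) - m)%:R - 1 = (npart (pconf par true) - m)%:R :> R.
    by rewrite -noe subSn -?natr1 ?addrK //; move: bar; rewrite -noe odd2; clear; lia.
  have csym k : connect_sym (move e k) by exact/sym_connect_sym/move_sym.
  apply: (metastable_hitting R io ie _ KL0 _ _ (D := D)).
  + by rewrite eq_sym.
  + by rewrite csym.
  + by rewrite csym.
  + by move: bar; rewrite -noe odd2; clear; lia.
  + by move=> z iz ze; rewrite -ltnS noe; exact: (even_unique_max G oK oL).
  + by move=> z iz zo ze; rewrite orbC; exact: shallow.
Qed.

End Assembly.

Theorem theorem2p1 (R : realType) (g : grid_kind) (K L : nat) :
  grid_ok g K L ->
  exists Gam : R, 0 < Gam /\
    hitting_asymptotics g (econf K L) (oconf K L) Gam /\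
    (g = Open -> odd (K * L) ->
       hitting_asymptotics g (oconf K L) (econf K L) (Gam - 1)).
Proof.
by move=> ok; exact: hard_core_hitting ok R.
Qed.
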